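(* Let $n\ge1$, let $G$ be a directed Dedekind monotone $\sigma$-complete po-group with interpolation, let $(H,u)$ be a unital po-group with interpolation, and let $F:\mathbb R^n\to E$ be an $n$-dimensional spectral resolution on $E=\Gamma_{ea}(H\,\overrightarrow{\times}\,G,(u,0))$. Suppose moreover that $F$ has only finitely many characteristic points. Then $F$ can be extended to an $n$-dimensional observable $x$ on $E$ such that $F=F_x$, i.e. $x((-\infty,t_1)\times\cdots\times(-\infty,t_n))=F(t_1,\ldots,t_n)$ for all $(t_1,\ldots,t_n)\in\mathbb R^n$.
   Context: All groups are Abelian and written additively. A po-group $G$ is Dedekind monotone $\sigma$-complete if every non-decreasing sequence in $G$ bounded above has a supremum in $G$; a po-group has interpolation if whenever $a_1,a_2\le b_1,b_2$ there is $c$ with $a_1,a_2\le c\le b_1,b_2$. A unital po-group $(H,u)$ is a po-group $H$ with a fixed strong unit $u\ge 0$ (every element of $H$ is $\le mu$ for some integer $m\ge1$). $H\,\overrightarrow{\times}\,G$ is $H\times G$ with lexicographic order: $(h,g)\le(h',g')$ iff $h<h'$, or $h=h'$ and $g\le g'$. $\Gamma_{ea}(H\,\overrightarrow{\times}\,G,(u,0))$ is the interval effect algebra $[(0,0),(u,0)]$, in which $a+b$ is the group sum, defined when it is $\le(u,0)$; bottom $0=(0,0)$, top $1=(u,0)$. For $h\in[0,u]_H=\{h\in H:0\le h\le u\}$ let $E_h$ be the set of elements of $E$ with first coordinate $h$. Suprema and infima below are taken in $E$. For $s,t\in\mathbb R^n$, $s\ll t$ (equivalently $t\gg s$) means $s_i<t_i$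 for all $i$; $s\wedge t$ is coordinatewise. For $F:\mathbb R^n\to E$ and reals $a\le b$, $\Delta_i(a,b)F$ is the function of the remaining variables $F(\ldots,t_{i-1},b,t_{i+1},\ldots)-F(\ldots,t_{i-1},a,t_{i+1},\ldots)$, computed in $H\,\overrightarrow{\times}\,G$. An $n$-dimensional spectral resolution on $E$ is a map $F:\mathbb R^n\to E$ such that: (i) (volume condition) $\Delta_1(a_1,b_1)\cdots\Delta_n(a_n,b_n)F\ge0$ for all reals $a_i\le b_i$; (ii) $\bigvee_{s\ll t}F(s)=F(t)$ for all $t\in\mathbb R^n$; (iii) $\bigwedge_{t_i\in\mathbb R}F(s_1,\ldots,s_{i-1},t_i,s_{i+1},\ldots,s_n)=0$ for each $i$ and all fixed values of the other variables; (iv) $\bigvee_{s\in\mathbb R^n}F(s)=1$; (v) for every characteristic point $\mathbf t^B$ of $F$, corresponding to a block $B\subseteq T_h$, the element $a_B=\bigwedge\{F(s): s\gg\mathbf t^B\}$ exists in $E$ and belongs to $E_h$. Here, for $h\in[0,u]_H$ with $h>0$, $T_h=\{t\in\mathbb R^n: F(t)\in E_h\}$. On $T_h$ one puts $s\sim t$ iff $s\wedge t\in T_h$; for $F$ satisfying (i)–(iv) this is an equivalence relation, and its classes are called blocks. The characteristic point of a block $B$ is the coordinatewise infimum $\mathbf t^B$ of $B$; the characteristic points of $F$ are those of all the blocks of all the sets $T_h$, $0<h\le u$. An $n$-dimensional observable on $E$ is a map $x:\mathcal B(\mathbb R^n)\to E$ on the Borel $\sigma$-algebra such that $x(\mathbb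 R^n)=1$; $x(A\cup B)=x(A)+x(B)$ (the sum being defined in $E$) for disjoint Borel sets $A,B$; and $x(\bigcup_iA_i)=\bigvee_i x(A_i)$ for every non-decreasing sequence $(A_i)_i$ of Borel sets. For an observable $x$, $F_x(t_1,\ldots,t_n):=x((-\infty,t_1)\times\cdots\times(-\infty,t_n))$. *)

(* Defs.v *)
From HB Require Import structures.
From mathcomp Require Import all_boot all_order all_algebra.
From mathcomp Require Import all_classical all_reals all_analysis.

Set Implicit Arguments.
Unset Strict Implicit.
Unset Printing Implicit Defensive.

Import Order.TTheory GRing.Theory Num.Theory.
Import numFieldNormedType.Exports.

Local Open Scope classical_set_scope.
Local Open Scope ring_scope.

(* [porderZmodType] is an abelian group with an unrelated partial order; the
   compatibility of the two is this hypothesis. *)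
Definition po_group (G : porderZmodType) : Prop :=
  forall x y z : G, x <= y -> x + z <= y + z.

Definition directed_group (G : porderZmodType) : Prop :=
  forall x y : G, exists z : G, x <= z /\ y <= z.

Definition monotone_sigma_complete (G : porderZmodType) : Prop :=
  forall f : nat -> G, nondecreasing_seq f ->
    ubound (range f) !=set0 -> supremums (range f) !=set0.

Definition interpolation (G : porderZmodType) : Prop :=
  forall a1 a2 b1 b2 : G, a1 <= b1 -> a1 <= b2 -> a2 <= b1 -> a2 <= b2 ->
    exists c : G, [/\ a1 <= c, a2 <= c, c <= b1 & c <= b2].

Definition strong_unit (H : porderZmodType) (u : H) : Prop :=
  0 <= u /\ forall h : H, exists2 m : nat, (1 <= m)%N & h <= u *+ m.

Definition lexprod (H G : porderZmodType) : Type := H *lexi[ring_display] G.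

HB.instance Definition _ (H G : porderZmodType) :=
  Order.POrder.copy (lexprod H G) (H *lexi[ring_display] G).
HB.instance Definition _ (H G : porderZmodType) :=
  GRing.Zmodule.copy (lexprod H G) (H * G)%type.

Lemma lexprod_leE (H G : porderZmodType) (p q : lexprod H G) :
  (p <= q) = (p.1 < q.1) || ((p.1 == q.1) && (p.2 <= q.2)).
Proof.
rewrite /Order.le /= /Order.ProdLexiOrder.le lt_neqAle.
case: (eqVneq p.1 q.1) => [->|ne] /=; first by rewrite lexx.
rewrite orbF; case: (boolP (p.1 <= q.1)) => //= le1.
by have [le2|//] := boolP (q.1 <= p.1); case/eqP: ne; apply/le_anti/andP.
Qed.

(* Carrier of the interval effect algebra [0, w]. Its partial sum [a + b = c] is
   the group sum, defined when [a + b <= w]. *)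
Definition Gamma_ea (K : porderZmodType) (w : K) : set K :=
  [set a | 0 <= a <= w].

(* Suprema and infima computed inside a subset [E] of a poset. *)
Definition sup_in (K : porderZmodType) (E S : set K) (a : K) : Prop :=
  (E `&` ubound S) a /\ lbound (E `&` ubound S) a.

Definition inf_in (K : porderZmodType) (E S : set K) (a : K) : Prop :=
  (E `&` lbound S) a /\ ubound (E `&` lbound S) a.

Section EuclideanSpace.
Variables (R : realType) (n : nat).
Implicit Types (s t : 'rV[R]_n) (i : 'I_n).

Definition rV_ll s t : Prop := forall i, s 0 i < t 0 i.

Definition rV_meet s t : 'rV[R]_n := \row_i Num.min (s 0 i) (t 0 i).

Definition rV_upd t i (r : R) : 'rV[R]_n :=
  \row_j (if j == i then r else t 0 j).

Definition borel_rV : set (set 'rV[R]_n) := <<s [set A | open A] >>.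

End EuclideanSpace.

(* [Delta i a b f] is kept as a function of all the variables; it does not
   depend on the i-th one. *)
Definition Delta (R : realType) (n : nat) (K : porderZmodType) (i : 'I_n)
    (a b : R) (f : 'rV[R]_n -> K) : 'rV[R]_n -> K :=
  fun t => f (rV_upd t i b) - f (rV_upd t i a).

Definition Delta_all (R : realType) (n : nat) (K : porderZmodType)
    (a b : 'rV[R]_n) (f : 'rV[R]_n -> K) : 'rV[R]_n -> K :=
  foldr (fun i g => Delta i (a 0 i) (b 0 i) g) f (enum 'I_n).

Section SpectralResolution.
Variables (R : realType) (n : nat) (H G : porderZmodType) (u : H).
Implicit Types (F : 'rV[R]_n -> lexprod H G) (h : H).

Definition lex_ea : set (lexprod H G) :=
  Gamma_ea ((u, 0) : lexprod H G).

Definition ea_level h : set (lexprod H G) := [set a | lex_ea a /\ a.1 = h].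

Definition Tset F h : set 'rV[R]_n := [set t | ea_level h (F t)].

(* The class of [t] for [s ~ t <-> s /\ t \in T_h] on [T_h]. *)
Definition block_of F h (t : 'rV[R]_n) : set 'rV[R]_n :=
  [set s | Tset F h s /\ Tset F h (rV_meet s t)].

Definition is_block F h (B : set 'rV[R]_n) : Prop :=
  exists2 t, Tset F h t & B = block_of F h t.

(* [p] is the coordinatewise infimum of [B]. *)
Definition rV_infimum (B : set 'rV[R]_n) (p : 'rV[R]_n) : Prop :=
  forall i, infimums [set s 0 i | s in B] (p 0 i).

Definition characteristic_at F h (p : 'rV[R]_n) : Prop :=
  exists2 B, is_block F h B & rV_infimum B p.

Definition characteristic_points F : set 'rV[R]_n :=
  [set p | exists h, [/\ 0 < h, h <= u & characteristic_at F h p]].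

Record spectral_resolution F : Prop := SpectralResolution {
  sr_in_ea : forall t, lex_ea (F t);
  sr_volume : forall a b : 'rV[R]_n, (forall i, a 0 i <= b 0 i) ->
    forall t, 0 <= Delta_all a b F t;
  sr_left_continuous : forall t, sup_in lex_ea [set F s | s in [set s | rV_ll s t]] (F t);
  sr_bottom : forall (s : 'rV[R]_n) i,
    inf_in lex_ea (range (fun r : R => F (rV_upd s i r))) 0;
  sr_top : sup_in lex_ea (range F) (u, 0);
  sr_characteristic : forall h p, 0 < h -> h <= u -> characteristic_at F h p ->
    exists2 a, inf_in lex_ea [set F s | s in [set s | rV_ll p s]] a & ea_level h a
}.

End SpectralResolution.

(* Only the values of [x] on Borel sets matter. *)
Record observable (R : realType) (n : nat) (K : porderZmodType) (w : K)
    (x : set 'rV[R]_n -> K) : Prop := Observable {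
  obs_in_ea : forall A, borel_rV A -> Gamma_ea w (x A);
  obs_setT : x setT = w;
  obs_additive : forall A B, borel_rV A -> borel_rV B -> A `&` B = set0 ->
    x A + x B <= w /\ x (A `|` B) = x A + x B;
  obs_continuous : forall A : nat -> set 'rV[R]_n,
    (forall k, borel_rV (A k)) ->
    (forall k l, (k <= l)%N -> A k `<=` A l) ->
    sup_in (Gamma_ea w) (range (x \o A)) (x (\bigcup_k A k))
}.

(* Main.v *)
(** The measure is first built with values in G, by forcing. In a monotone
    sigma-complete interpolation group, if b is not >= 0 then, for any countably
    many elements and countably many sequences decreasing to 0, there is a
    positive real functional that is negative at b, additive on the given
    elements and continuous along the given sequences: such a functional is read
    off a sequence of elements b_j that are not >= 0 and decide more and more of
    it, as in the Rasiowa-Sikorski lemma. Applied to the values of a G-valued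
    distribution function f, it gives a real distribution function, hence a
    random vector. Now every Borel set A gets a value in G, by induction on its
    construction, such that sufficiently generic functionals s send this value
    to the probability of A for the distribution function s o f; two values that
    are in the wrong order would be separated by a generic s, so the value of A
    is well defined and monotone in A.

    For the spectral resolution F = (h, g), the finitely many characteristic
    points make h constant on the cells of a finite grid, and their lower bounds
    a_B make g bounded below on each cell. So h is a finite sum of point masses
    at grid points, and the volumes of F on the boxes [q, q + e[ have a limit
    (m, w) as e decreases to 0 whenever q is a grid point of mass m > 0. Once
    these finitely many atoms are subtracted from F, the first component
    vanishes and the second one is a G-valued distribution function. *)
Require Import Defs.
From mathcomp Require Import all_boot all_order all_algebra.
From mathcomp Require Import all_classical all_reals all_analysis.
From mathcomp Require Import ring lra.

Set Implicit Arguments.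
Unset Strict Implicit.
Unset Printing Implicit Defensive.

Import Order.TTheory GRing.Theory Num.Theory.
Import numFieldNormedType.Exports.

Local Open Scope classical_set_scope.
Local Open Scope ring_scope.

(** A functional is made additive and continuous on countably many data only, whereas there are
    uncountably many points and Borel sets. So [f] is sampled at rational points, each Borel set
    carries its own countable certificate, and two Borel sets are compared through a functional
    chosen for that pair. The functionals are obtained as infima of cuts, hence are only sublinear,
    and they are controlled only on elements bounded by multiples of [v], which need not be an order
    unit of G.

    The lexicographic order is the second obstacle: a supremum or infimum in E says something about
    the G-component only where the H-component is constant. Limits are therefore taken inside one
    grid cell. That the H-component does not jump at a supremum follows by lowering the G-component
    by a positive element of G, or trivially if G is zero.

    Removing the atoms keeps box volumes non-negative, but not obviously monotonicity. This is
    recovered from boxes whose lower corners go to minus infinity, where the atoms contribute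
    nothing. *)

(** * Identities of abelian groups, by comparison of integer coefficients *)

Inductive zexpr : Type :=
| ZVar of nat | ZZero | ZAdd of zexpr & zexpr | ZOpp of zexpr | ZMul of zexpr & nat.

Fixpoint zeval (G : zmodType) (env : seq G) (e : zexpr) : G :=
  match e with
  | ZVar i => nth 0 env i
  | ZZero => 0
  | ZAdd e1 e2 => zeval env e1 + zeval env e2
  | ZOpp e1 => - zeval env e1
  | ZMul e1 m => zeval env e1 *+ m
  end.

Fixpoint zcoef (e : zexpr) (i : nat) : int :=
  match e with
  | ZVar j => if i == j then 1 else 0
  | ZZero => 0
  | ZAdd e1 e2 => zcoef e1 i + zcoef e2 i
  | ZOpp e1 => - zcoef e1 i
  | ZMul e1 m => zcoef e1 i *+ m
  end.

Lemma zevalE (G : zmodType) (env : seq G) (e : zexpr) :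
  zeval env e = \sum_(i < size env) env`_i *~ zcoef e i.
Proof.
elim: e => [j||e1 IH1 e2 IH2|e1 IH1|e1 IH1 m] /=.
- have [lt_j|le_j] := ltnP j (size env).
    rewrite (bigD1 (Ordinal lt_j)) //= eqxx big1 ?addr0 // => i.
    by rewrite -val_eqE /= => /negPf ->.
  rewrite nth_default // big1 // => i _.
  by rewrite ltn_eqF // (leq_trans (ltn_ord i)).
- by rewrite big1.
- by rewrite IH1 IH2 -big_split; apply: eq_bigr => i _; rewrite mulrzDr.
- by rewrite IH1 -sumrN; apply: eq_bigr => i _; rewrite mulrNz.
- rewrite IH1 -sumrMnl; apply: eq_bigr => i _.
  by elim: m => [|m IHm]; rewrite ?mulrS ?mulrzDr ?IHm.
Qed.

Lemma zeval_eq (G : zmodType) (env : seq G) (e1 e2 : zexpr) :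
  all (fun i => zcoef e1 i == zcoef e2 i) (iota 0 (size env)) ->
  zeval env e1 = zeval env e2.
Proof.
move=> /allP e12; rewrite !zevalE; apply: eq_bigr => i _.
by rewrite (eqP (e12 i _)) // mem_iota /=.
Qed.

Ltac zmod_head x := match x with ?f _ => zmod_head f | _ => x end.

(* Atoms are compared up to conversion, because the structures that they carry
   may be inferred along different paths. *)
Ltac zmod_same x y :=
  match constr:((x, y)) with
  | (?z, ?z) => constr:(true)
  | (@GRing.natmul _ ?a ?m, @GRing.natmul _ ?b ?m) => zmod_same a b
  | _ =>
      let f := zmod_head x in let g := zmod_head y in
      match constr:((f, g)) with
      | (?h, ?h) =>
          match goal with
          | _ => let e := constr:(erefl x : x = y) in constr:(true)
          | _ => constr:(false)
          end
      | _ => constr:(false)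
      end
  end.

Ltac zmod_mem x s :=
  match s with
  | nil => constr:(false)
  | ?y :: ?s' => let b := zmod_same x y in match b with
                 | true => constr:(true)
                 | false => zmod_mem x s'
                 end
  end.

Ltac zmod_index x s :=
  match s with
  | ?y :: ?s' => let b := zmod_same x y in match b with
                 | true => constr:(0%N)
                 | false => let k := zmod_index x s' in constr:(k.+1)
                 end
  end.

Ltac zmod_numeral m :=
  match m with
  | O => idtac
  | S ?m' => zmod_numeral m'
  end.

Ltac zmod_atoms G s t :=
  match t with
  | @GRing.zero _ => s
  | @GRing.add _ ?a ?b => let s1 := zmod_atoms G s a in zmod_atoms G s1 b
  | @GRing.opp _ ?a => zmod_atoms G s a
  | @GRing.natmul _ ?a ?m =>
      let _ := match goal with _ => zmod_numeral m end in zmod_atoms G s a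
  | _ => let b := zmod_mem t s in match b with
         | true => s
         | false => constr:(@cons G t s)
         end
  end.

Ltac zmod_reify s t :=
  match t with
  | @GRing.zero _ => constr:(ZZero)
  | @GRing.add _ ?a ?b =>
      let a' := zmod_reify s a in let b' := zmod_reify s b in
      constr:(ZAdd a' b')
  | @GRing.opp _ ?a => let a' := zmod_reify s a in constr:(ZOpp a')
  | @GRing.natmul _ ?a ?m =>
      let _ := match goal with _ => zmod_numeral m end in
      let a' := zmod_reify s a in constr:(ZMul a' m)
  | _ => let k := zmod_index t s in constr:(ZVar k)
  end.

(* Decides equalities that hold in every abelian group. *)
Ltac zmod :=
  match goal with
  | |- @eq ?G ?a ?b =>
      let s0 := zmod_atoms G (@nil G) a in
      let s := zmod_atoms G s0 b in
      let a' := zmod_reify s a in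
      let b' := zmod_reify s b in
      change (zeval s a' = zeval s b');
      apply: zeval_eq; vm_compute; reflexivity
  end.


(** Dependent choice along an invariant: pairing each point with its proof of [P] turns the step
    into a function that can be iterated. *)
Lemma invariant_choice (T : Type) (P : T -> Prop) (Q : nat -> T -> T -> Prop) x0 :
  P x0 -> (forall k x, P x -> exists2 y, P y & Q k x y) ->
  exists f : nat -> T,
    [/\ f 0%N = x0, forall k, P (f k) & forall k, Q k (f k) (f k.+1)].
Proof.
move=> Px0 step.
have step' (kx : nat * {x | P x}) :
    {y : {x | P x} | Q kx.1 (sval kx.2) (sval y)}.
  by apply: cid; case: kx => k [x Px]; have [y Py Qxy] := step k x Px; exists (exist _ y Py).
pose f := nat_rect (fun=> {x | P x}) (exist _ x0 Px0) (fun k x => sval (step' (k, x))).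
exists (fun k => sval (f k)); split=> // k; first exact: (svalP (f k)).
exact: (svalP (step' (k, f k))).
Qed.

(** * Partially ordered abelian groups *)

Section POGroup.
Variables (G : porderZmodType) (hG : po_group G).
Implicit Types (a b c d : G).

Lemma po_leD a b c d : a <= b -> c <= d -> a + c <= b + d.
Proof.
move=> ab cd; apply: le_trans (hG c ab) _.
by rewrite ![b + _]addrC; apply: hG.
Qed.

Lemma po_le_by a b c d : c <= d -> b - a = d - c -> a <= b.
Proof.
move=> cd e; have := hG (a - c) cd; congr (_ <= _); first by zmod.
by rewrite -[b](subrK a) e; zmod.
Qed.

Lemma po_sub_ge0 a b : (0 <= b - a) = (a <= b).
Proof. by apply/idP/idP => ab; apply: (po_le_by ab); zmod. Qed.

Lemma po_leN a b : a <= b -> - b <= - a.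
Proof. by move=> ab; apply: (po_le_by ab); zmod. Qed.

Lemma po_leMn a b k : a <= b -> a *+ k <= b *+ k.
Proof.
move=> ab; elim: k => [|k IHk]; first by rewrite !mulr0n.
by rewrite !mulrS; apply: po_leD.
Qed.

Lemma po_Mn_ge0 a k : 0 <= a -> 0 <= a *+ k.
Proof. by move=> /(po_leMn k); rewrite mul0rn. Qed.

Lemma po_leMnr a k l : 0 <= a -> (k <= l)%N -> a *+ k <= a *+ l.
Proof.
move=> a0 kl; rewrite -(subnKC kl) mulrnDr.
by apply: (po_le_by (po_Mn_ge0 (l - k)%N a0)); zmod.
Qed.

Lemma po_sum_le (I : Type) (r : seq I) (P : pred I) (f1 f2 : I -> G) :
  (forall i, P i -> f1 i <= f2 i) -> \sum_(i <- r | P i) f1 i <= \sum_(i <- r | P i) f2 i.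
Proof. by move=> le12; apply: (big_ind2 (fun x y => x <= y)) => // *; apply: po_leD. Qed.

Lemma po_sum_ge0 (I : Type) (r : seq I) (P : pred I) (f : I -> G) :
  (forall i, P i -> 0 <= f i) -> 0 <= \sum_(i <- r | P i) f i.
Proof.
move=> f0; apply: (big_ind (fun x => 0 <= x)) => // x y x0 y0.
by rewrite -[0]addr0; apply: po_leD.
Qed.

Definition seq_lub (x : nat -> G) z :=
  (forall k, x k <= z) /\ forall y, (forall k, x k <= y) -> z <= y.

Definition seq_glb (x : nat -> G) z :=
  (forall k, z <= x k) /\ forall y, (forall k, y <= x k) -> y <= z.

Definition decr_to0 (x : nat -> G) := (forall k, x k.+1 <= x k) /\ seq_glb x 0.

Lemma decr_le (x : nat -> G) k l : (forall k, x k.+1 <= x k) -> (k <= l)%N -> x l <= x k.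
Proof.
move=> dx kl; rewrite -(subnKC kl); elim: (l - k)%N => [|m IHm]; first by rewrite addn0.
by rewrite addnS; apply: le_trans IHm.
Qed.

Lemma incr_le (x : nat -> G) k l : (forall k, x k <= x k.+1) -> (k <= l)%N -> x k <= x l.
Proof.
move=> dx kl; rewrite -(subnKC kl); elim: (l - k)%N => [|m IHm]; first by rewrite addn0.
by rewrite addnS; apply: le_trans (dx _).
Qed.

Lemma decr_to0_ge0 (x : nat -> G) k : decr_to0 x -> 0 <= x k.
Proof. by case=> _ []. Qed.

(** The indices decouple: a lower bound of all [x k + y k] is below every [x k + y l], as is seen at
    the larger index, so the two infima are taken one after the other. *)
Lemma decr_to0D (x y : nat -> G) :
  decr_to0 x -> decr_to0 y -> decr_to0 (fun k => x k + y k).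
Proof.
move=> [dx [x0 xl]] [dy [y0 yl]]; split=> [k|]; first exact: po_leD.
split=> [k|z zxy]; first by rewrite -[0]addr0; apply: po_leD.
apply: xl => k; apply: (@po_le_by _ _ (z - x k) 0); last by zmod.
apply: yl => l; apply: (@po_le_by _ _ z (x k + y l)); last by zmod.
apply: le_trans (zxy (maxn k l)) _; apply: po_leD.
  by apply: decr_le => //; apply: leq_maxl.
by apply: decr_le => //; apply: leq_maxr.
Qed.

Lemma decr_to0Mn (x : nat -> G) m : decr_to0 x -> decr_to0 (fun k => x k *+ m).
Proof.
move=> x0; elim: m => [|m IHm]; first by split=> //; split=> // y /(_ 0%N).
have := decr_to0D x0 IHm; congr decr_to0; apply: funext => k.
by rewrite mulrS.
Qed.

Lemma seq_lub_sub (x : nat -> G) z :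
  (forall k, x k <= x k.+1) -> seq_lub x z -> decr_to0 (fun k => z - x k).
Proof.
move=> dx [xz zl]; split=> [k|]; first by apply: (po_le_by (dx k)); zmod.
split=> [k|y yx]; first by rewrite po_sub_ge0.
suff: z <= z - y by move=> h; apply: (po_le_by h); zmod.
by apply: zl => k; apply: (po_le_by (yx k)); zmod.
Qed.

End POGroup.

(** * Generic states of interpolation groups *)

Section InterpolationGroup.
Variables (G : porderZmodType) (hG : po_group G) (dG : directed_group G).
Variables (sG : monotone_sigma_complete G) (iG : interpolation G).
Implicit Types (a b c d v y z : G).

Lemma seq_lub_exists (x : nat -> G) y :
  (forall k, x k <= x k.+1) -> (forall k, x k <= y) -> exists z, seq_lub x z.
Proof.
move=> dx xy.
have [||z [zx zl]] := @sG x; first by move=> k l; apply: incr_le.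
  by exists y => _ [k _ <-].
exists z; split=> [k|w xw]; first by apply: zx; exists k.
by apply: zl => _ [k _ <-].
Qed.

Lemma seq_glb_exists (x : nat -> G) y :
  (forall k, x k.+1 <= x k) -> (forall k, y <= x k) -> exists z, seq_glb x z.
Proof.
move=> dx xy; have [|k|z [zx zl]] := @seq_lub_exists (fun k => - x k) (- y).
- by move=> k; apply: po_leN.
- exact: po_leN.
exists (- z); split=> [k|w wx]; first by apply: (po_le_by hG (zx k)); zmod.
have zw : z <= - w by apply: zl => k; apply: po_leN.
by apply: (po_le_by hG zw); zmod.
Qed.

(** Interpolants below [y1] and [y2] are chosen recursively in increasing order, each above one more
    [x k]; sigma-completeness provides their supremum. *)
Lemma countable_interpolation (x : nat -> G) y1 y2 :
  (forall k, x k <= y1) -> (forall k, x k <= y2) ->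
  exists z, [/\ forall k, x k <= z, z <= y1 & z <= y2].
Proof.
move=> xy1 xy2.
have [|k z [zy1 zy2]|w [w0 wy dw]] := @invariant_choice _ (fun z => z <= y1 /\ z <= y2)
    (fun k z z' => z <= z' /\ x k.+1 <= z') (x 0%N).
- by split.
- have [c [zc xc cy1 cy2]] := iG zy1 zy2 (xy1 k.+1) (xy2 k.+1).
  by exists c.
have [k|z [wz zl]] := @seq_lub_exists w y1 (fun k => (dw k).1).
  by case: (wy k).
exists z; split; last by apply: zl => k; case: (wy k).
  by case=> [|k]; [rewrite -w0|apply: le_trans (dw k).2 _].
by apply: zl => k; case: (wy k).
Qed.

(** The upper bounds of all multiples of [a] are stable under subtraction of [a]. Interpolating, one
    gets such bounds with [w k.+1 <= w k - a]; their infimum [t] exists, since the multiple 0 bounds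
    them below, and satisfies [t + a <= t]. *)
Lemma archimedean a z : (forall k, a *+ k <= z) -> a <= 0.
Proof.
move=> az.
pose U y := forall k, a *+ k <= y.
have [//|_ y Uy|w [_ Uw dw]] :=
    @invariant_choice _ U (fun _ y y' => y' <= y /\ y' <= y - a) z.
  have Uya k : a *+ k <= y - a.
    by apply: (po_le_by hG (Uy k.+1)); rewrite mulrS; zmod.
  by have [c [ac cy cya]] := countable_interpolation Uy Uya; exists c.
have [k|k|t [tw tl]] := @seq_glb_exists w 0; first by case: (dw k).
  by have := Uw k 0%N.
have: t + a <= t.
  by apply: tl => k; apply: (po_le_by hG (le_trans (tw k.+1) (dw k).2)); zmod.
by move=> ta; apply: (po_le_by hG ta); zmod.
Qed.

Lemma upper_bound2 a b : exists2 c, a <= c & b <= c.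
Proof. by have [c []] := dG a b; exists c. Qed.

Lemma upper_bound_ge0 a : exists2 c, 0 <= c & a <= c.
Proof. exact: upper_bound2. Qed.

(** The multiples of [- a] are bounded: after division of [k] by [K], the quotient part contributes
    at most 0 and the remainder at most [c *+ K]. *)
Lemma unperforated a K : (0 < K)%N -> 0 <= a *+ K -> 0 <= a.
Proof.
move=> K0 aK; suff na0 : - a <= 0 by apply: (po_le_by hG na0); zmod.
have [c c0 ac] := upper_bound_ge0 (- a).
apply: (@archimedean _ (c *+ K)) => k.
rewrite {1}(divn_eq k K) mulrnDr mulnC mulrnA -[c *+ K]add0r.
apply: po_leD => //.
  rewrite -(mul0rn _ (k %/ K)); apply: po_leMn => //.
  by rewrite mulNrn; apply: (po_le_by hG aK); zmod.
apply: le_trans (po_leMn hG _ ac) _; apply: po_leMnr => //.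
by rewrite ltnW // ltn_mod.
Qed.

(* Below, [~ 0 <= b] is read as the statement that some state is negative at
   [b]; the next lemmas refine this statement. *)
Lemma not_ge0_double b : ~ 0 <= b -> exists y, [/\ b <= y, b *+ 2 <= y & ~ 0 <= y].
Proof.
move=> b0; apply: contrapT => noy.
have y0 y : b <= y -> b *+ 2 <= y -> 0 <= y.
  by move=> by1 by2; apply: contrapT => ny; apply: noy; exists y.
have [w w0 bw] := upper_bound_ge0 (- b).
(* By contradiction, every common upper bound of [b] and [b *+ 2] is non-negative. The induction
   hypotheses say that [w + b *+ k + b *+ 2] is such a bound. Hence all multiples of [- b] stay
   below [w]. *)
have Uw k : 0 <= w + b *+ k /\ - b <= w + b *+ k.
  elim: k => [|k [IH0 IHb]]; first by rewrite mulr0n addr0.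
  have step : - b <= w + b *+ k.+1.
    have H : 0 <= w + b *+ k + b *+ 2.
      by apply: y0; [apply: (po_le_by hG IHb)|apply: (po_le_by hG IH0)]; zmod.
    by apply: (po_le_by hG H); rewrite mulrS; zmod.
  by split=> //; apply: (po_le_by hG IHb); rewrite mulrS; zmod.
apply: b0; suff nb : - b <= 0 by apply: (po_le_by hG nb); zmod.
apply: (@archimedean _ w) => k; rewrite mulNrn.
by apply: (po_le_by hG (Uw k).1); zmod.
Qed.

(** If this failed, every [y] above both [b] and [- v] would be non-negative. Adding [v] improves a
    lower bound [- (v *+ m.+1)] to [- (v *+ m)], so by induction [b] itself would be
    non-negative. *)
Lemma not_ge0_truncate v b N : 0 <= v -> - (v *+ N) <= b -> ~ 0 <= b ->
  exists y, [/\ b <= y, - v <= y & ~ 0 <= y].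
Proof.
move=> v0 vb b0; apply: contrapT => noy.
have y0 y : b <= y -> - v <= y -> 0 <= y.
  by move=> by1 vy; apply: contrapT => ny; apply: noy; exists y.
apply: b0; suff h m y : b <= y -> - (v *+ m) <= y -> 0 <= y by apply: (h N).
elim: m y => [|m IHm] y by1; first by rewrite mulr0n oppr0.
rewrite mulrS => vy; apply: y0 => //.
have : 0 <= y + v.
  apply: IHm; last by apply: (po_le_by hG vy); zmod.
  by apply: le_trans by1 _; apply: (po_le_by hG v0); zmod.
by move=> h; apply: (po_le_by hG h); zmod.
Qed.

(** A state negative at the new [y] is less than 1 at [c k]. If no [k] worked for the truncated [y],
    all [y + c k] would be non-negative, and so would [y]. *)
Lemma not_ge0_decr_to0 v b N (c : nat -> G) : 0 <= v -> - (v *+ N) <= b ->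
  decr_to0 c -> ~ 0 <= b -> exists k y, [/\ b <= y, c k - v <= y & ~ 0 <= y].
Proof.
move=> v0 vb c0 b0; have [y [by1 vy y0]] := not_ge0_truncate v0 vb b0.
apply: contrapT => noy.
apply: y0; suff ny : - y <= 0 by apply: (po_le_by hG ny); zmod.
have [_ [_ cl]] := c0; apply: cl => k.
suff h : 0 <= y + c k by apply: (po_le_by hG h); zmod.
apply: contrapT => h; apply: noy; exists k, (y + c k); split=> //.
  by apply: le_trans by1 _; apply: (po_le_by hG (decr_to0_ge0 k c0)); zmod.
by apply: (po_le_by hG vy); zmod.
Qed.

(** The archimedean property for [- b]; it provides a margin [w] in later steps. *)
Lemma not_ge0_shift b w : 0 <= w -> ~ 0 <= b ->
  exists2 M, (0 < M)%N & ~ 0 <= b *+ M + w.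
Proof.
move=> w0 b0; apply: contrapT => noM.
apply: b0; suff nb : - b <= 0 by apply: (po_le_by hG nb); zmod.
apply: (@archimedean _ w) => -[|k]; first by rewrite mulr0n.
have h : 0 <= b *+ k.+1 + w by apply: contrapT => h; apply: noM; exists k.+1.
by rewrite mulNrn; apply: (po_le_by hG h); zmod.
Qed.

(** This decides the sign of a state at [g] up to one unit. If both choices failed, every element
    above [b *+ M] and above [g] or [- g - v] would be non-negative; interpolation writes [y2] as
    [c + (y2 - c)] with two such summands. *)
Lemma not_ge0_decide v b g N K : 0 <= v -> - (v *+ N) <= b ->
  - (v *+ K) <= g -> g <= v *+ K -> ~ 0 <= b ->
  exists M y, [/\ (0 < M)%N, b *+ M <= y, g <= y \/ - g - v <= y & ~ 0 <= y].
Proof.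
move=> v0 vb vg gv b0.
have vK0 := po_Mn_ge0 hG K v0.
(* The margin [v *+ K.+1] pays for the bounds of [g] in the two mixed inequalities of the
   interpolation below; doubling yields [d <= y2 - d], and truncation [g <= y2 + g + v]. *)
have [M M0 bM0] := not_ge0_shift (po_Mn_ge0 hG K.+1 v0) b0.
have [y1 [by1 b2y1 y10]] := not_ge0_double bM0.
have vy1 : - (v *+ (N * M)) <= y1.
  apply: le_trans by1; rewrite mulrnA.
  apply: (po_le_by hG (po_leD hG (po_leMn hG M vb) (po_Mn_ge0 hG K.+1 v0))).
  by rewrite mulNrn; zmod.
have [y2 [y12 vy2 y20]] := not_ge0_truncate v0 vy1 y10.
apply: contrapT => noy.
have inc y : b *+ M <= y -> g <= y \/ - g - v <= y -> 0 <= y.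
  by move=> by0 gy; apply: contrapT => ny; apply: noy; exists M, y.
set d := b *+ M in inc bM0 by1 b2y1 *.
rewrite mulrS in bM0 by1 b2y1.
have dy2 : d + (v + v *+ K) <= y2 by apply: le_trans y12.
have [c [dc gc cy1 cy2]] : exists c, [/\ d <= c, g <= c, c <= y2 - d & c <= y2 + g + v].
  apply: iG.
  - have h := le_trans b2y1 y12.
    have := po_leD hG h (po_leD hG v0 (po_leD hG v0 (po_leD hG vK0 vK0))).
    by move=> {}h; apply: (po_le_by hG h); zmod.
  - by apply: (po_le_by hG (po_leD hG (po_leD hG dy2 vg) (po_leD hG v0 v0))); zmod.
  - by apply: (po_le_by hG (po_leD hG (po_leD hG dy2 v0) gv)); zmod.
  - by apply: (po_le_by hG vy2); zmod.
apply: y20.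
have c0 : 0 <= c by apply: inc => //; left.
have yc0 : 0 <= y2 - c.
  apply: inc; first by apply: (po_le_by hG cy1); zmod.
  by right; apply: (po_le_by hG cy2); zmod.
by apply: (po_le_by hG (po_leD hG c0 yc0)); zmod.
Qed.

Definition bounded_by v g := exists K, - (v *+ K) <= g /\ g <= v *+ K.

Lemma bounded_byN v g : bounded_by v g -> bounded_by v (- g).
Proof.
by case=> K [vg gv]; exists K; split; [exact: po_leN|apply: (po_le_by hG vg); zmod].
Qed.

Lemma bounded_byD v g h : bounded_by v g -> bounded_by v h -> bounded_by v (g + h).
Proof.
move=> [K [vg gv]] [L [vh hv]]; exists (K + L)%N; rewrite mulrnDr.
by split; [apply: (po_le_by hG (po_leD hG vg vh)); zmod|exact: po_leD].
Qed.

Lemma bounded_byMn v g m : bounded_by v g -> bounded_by v (g *+ m).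
Proof.
move=> bg; elim: m => [|m IHm]; last by rewrite mulrS; exact: bounded_byD.
by rewrite mulr0n; exists 0%N; rewrite mulr0n oppr0.
Qed.

Lemma bounded_by_ge0 v g : 0 <= g -> g <= v -> bounded_by v g.
Proof.
move=> g0 gv; exists 1%N; split=> //.
by apply: (po_le_by hG (po_leD hG g0 (le_trans g0 gv))); zmod.
Qed.

Lemma bounded_byMz v (a : int) : 0 <= v -> bounded_by v (v *~ a).
Proof.
move=> v0; have bv : bounded_by v v by apply: bounded_by_ge0.
by case: a => k; [exact: bounded_byMn|apply/bounded_byN/bounded_byMn].
Qed.

Variable R : realType.

(** Subadditivity is all that an infimum over a cut guarantees; additivity is recovered at selected
    elements through [linear_at]. *)
Record state v (s : G -> R) : Prop := State {
  state_le : forall g h, bounded_by v g -> bounded_by v h -> g <= h -> s g <= s h;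
  state_subadd : forall g h, bounded_by v g -> bounded_by v h -> s (g + h) <= s g + s h;
  state_0 : s 0 = 0;
  state_unit : s v = 1
}.

(** * Real functionals from cuts *)

Section Cut.
Variables (v : G) (N : set G).
Hypotheses (v0 : 0 <= v) (N_le : forall g h, g <= h -> N h -> N g).
Hypotheses (N_add : forall g h, N g -> N h -> N (g + h)) (N0 : ~ N 0) (Nv : N (- v)).

(** [N] stands for the elements declared negative: [p / q] is an upper estimate of the value at [g]
    when [g *+ q - v *~ p] is one of them. *)
Definition cut_set g : set R :=
  [set x | exists q p, [/\ (0 < q)%N, x = p%:~R / q%:R & N (g *+ q - v *~ p)]].

Definition cut g : R := inf (cut_set g).

Let N_Mn g m : (0 < m)%N -> N g -> N (g *+ m).
Proof.
case: m => // m _ Ng; elim: m => [//|m IHm].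
by rewrite mulrS; apply: N_add.
Qed.

Let N_unit (a : int) : N (v *~ a) <-> a < 0.
Proof.
split=> [Na|]; last first.
  by case: a => // k _; rewrite NegzE mulrNz -mulNrn; apply: N_Mn.
case: a Na => // k Nk; exfalso; apply: N0; apply: N_le Nk.
exact: po_Mn_ge0.
Qed.

Lemma has_inf_cut g : bounded_by v g -> has_inf (cut_set g).
Proof.
move=> [K [vg gv]]; split.
  exists (K.+1%:Z%:~R / 1%:R), 1%N, K.+1; split=> //.
  apply: N_le (Nv); apply: (po_le_by hG gv).
  by rewrite -pmulrn (mulrS v); zmod.
exists (- K%:R) => _ [q [p [q0 -> Nq]]].
have : N (v *~ (- (K * q)%N%:Z - p)).
  apply: N_le Nq; apply: (po_le_by hG (po_leMn hG q vg)).
  by rewrite mulrzBr mulrNz -pmulrn mulrnA mulNrn; zmod.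
move=> /N_unit; rewrite subr_lt0 -(ltr_int R) mulrNz -pmulrn natrM => /ltW h.
by rewrite ler_pdivlMr ?ltr0n // mulNr.
Qed.

Lemma cut_le g q (p : int) : bounded_by v g -> (0 < q)%N -> N (g *+ q - v *~ p) ->
  cut g <= p%:~R / q%:R.
Proof. by move=> /has_inf_cut[_ bg] q0 Nq; apply: ge_inf => //; exists q, p. Qed.

Lemma cut_ge g x : bounded_by v g ->
  (forall q (p : int), (0 < q)%N -> N (g *+ q - v *~ p) -> x <= p%:~R / q%:R) ->
  x <= cut g.
Proof.
move=> /has_inf_cut[g0 _] gx; apply: lb_le_inf => // _ [q [p [q0 -> Nq]]].
exact: gx.
Qed.

Lemma cut_Mz (a : int) : cut (v *~ a) = a%:~R.
Proof.
have ba := bounded_byMz a v0.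
apply/eqP; rewrite eq_le; apply/andP; split.
  apply/ler_addgt0Pr => e e0.
  have [q eq] : exists q : nat, e^-1 < q%:R.
    by exists (Num.truncn e^-1).+1; apply: truncnS_gt.
  have q0 : 0 < q%:R :> R by apply: lt_trans eq; rewrite invr_gt0.
  apply: le_trans (@cut_le _ q (a * q%:Z + 1) ba _ _) _.
  - by rewrite -(ltr0n R).
  - by rewrite mulrzDr mulrzA -pmulrn opprD addrA subrr sub0r.
  - rewrite rmorphD /= intrM -pmulrn mulrDl mulfK ?gt_eqF // lerD2l mul1r.
    by rewrite invf_ple ?posrE // ltW.
apply: cut_ge => // q p q0.
have -> : v *~ a *+ q - v *~ p = v *~ (a * q%:Z - p) by rewrite mulrzBr mulrzA -pmulrn.
move=> /N_unit.
rewrite subr_lt0 -(ltr_int R) intrM -pmulrn => /ltW h.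
by rewrite ler_pdivlMr // ltr0n.
Qed.

Lemma state_cut : state v cut.
Proof.
split=> [g h bg bh gh|g h bg bh||]; last exact: (cut_Mz 1);
  last by rewrite -(mulr0z v) cut_Mz.
- apply: cut_ge => // q p q0 Nq; apply: cut_le => //.
  by apply: N_le Nq; apply: (po_le_by hG (po_leMn hG q gh)); zmod.
- rewrite -lerBlDr; apply: cut_ge => // q p q0 Nq.
  rewrite lerBlDr -lerBlDl; apply: cut_ge => // q' p' q0' Nq'.
  rewrite lerBlDl.
  have qq0 : (0 < q * q')%N by rewrite muln_gt0 q0.
  apply: le_trans (@cut_le _ (q * q') (p * q'%:Z + p' * q%:Z) (bounded_byD bg bh) qq0 _) _.
    have := N_add (N_Mn q0' Nq) (N_Mn q0 Nq').
    rewrite !mulrnBl -!mulrnA !pmulrn -!mulrzA [(q' * q)%N]mulnC mulrzDl mulrzDr.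
    by congr N; zmod.
  rewrite natrM rmorphD /= !intrM -!pmulrn le_eqVlt; apply/orP; left; apply/eqP.
  have : q%:R != 0 :> R by rewrite pnatr_eq0 -lt0n.
  have : q'%:R != 0 :> R by rewrite pnatr_eq0 -lt0n.
  by move=> ? ?; field; apply/andP.
Qed.

Lemma cut_additive g : bounded_by v g ->
  (forall q (p : int), N (g *+ q - v *~ p) \/ N (- (g *+ q - v *~ p) - v)) ->
  cut (- g) = - cut g.
Proof.
move=> bg dec; have bNg := bounded_byN bg.
have c0 := state_0 state_cut.
apply/eqP; rewrite eq_le; apply/andP; split; last first.
  by rewrite -subr_ge0 opprK -[X in X <= _]c0 -(addNr g); apply: (state_subadd state_cut).
apply/ler_addgt0Pr => e e0.
(* The estimate obtained is [(1 - p) / q] with [q * cut g - 2 < p], so it exceeds [- cut g] by less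
   than [3 / q]. *)
have [q eq] : exists q : nat, 3 / e < q%:R.
  by exists (Num.truncn (3 / e)).+1; apply: truncnS_gt.
have q0 : 0 < q%:R :> R by apply: lt_trans eq; rewrite divr_gt0.
have q0' : (0 < q)%N by rewrite -(ltr0n R).
(* One less than the floor, so that [p / q] lies strictly below [cut g] and the first alternative of
   [dec] is impossible. *)
pose p : int := Num.floor (q%:R * cut g) - 1.
have p1 : p%:~R + 1 <= q%:R * cut g by rewrite rmorphB /= subrK Num.Theory.floor_le.
have p2 : q%:R * cut g < p%:~R + 2.
  by rewrite rmorphB /=; have := floorD1_gt (q%:R * cut g); rewrite rmorphD /=; lra.
have [Np|Np] := dec q p.
  have := cut_le bg q0' Np; rewrite ler_pdivlMr // mulrC => h.
  by have := le_trans p1 h; rewrite gerDl ler10.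
have := @cut_le (- g) q (1 - p) bNg q0'; rewrite rmorphB /= => h.
apply: le_trans (h _) _.
  by congr N: Np; rewrite mulNrn (mulrzBr v 1 p) mulr1z; zmod.
rewrite ler_pdivrMr //.
move: eq; rewrite ltr_pdivrMr // => eq.
by nra.
Qed.

End Cut.

(** For a subadditive functional this already gives [s (g + h) = s g + s h] for every bounded [h],
    because [h = (g + h) - g]. *)
Definition linear_at (s : G -> R) g := s (- g) = - s g.

Section StateTheory.
Variables (v : G) (s : G -> R) (hs : state v s).

Lemma linear_at0 : linear_at s 0.
Proof. by rewrite /linear_at oppr0 (state_0 hs) oppr0. Qed.

Lemma linear_atN g : linear_at s g -> linear_at s (- g).
Proof. by rewrite /linear_at opprK => ->; rewrite opprK. Qed.

Lemma state_add g h : bounded_by v g -> bounded_by v h -> linear_at s g ->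
  s (g + h) = s g + s h.
Proof.
move=> bg bh lg; apply: le_anti; rewrite (state_subadd hs) //= addrC -lerBrDr.
rewrite -lg [X in s X <= _](_ : h = g + h - g); last by zmod.
by apply: (state_subadd hs); [exact: bounded_byD|exact: bounded_byN].
Qed.

Lemma linear_atD g h : bounded_by v g -> bounded_by v h ->
  linear_at s g -> linear_at s h -> linear_at s (g + h).
Proof.
move=> bg bh lg lh; rewrite /linear_at opprD state_add ?state_add //.
- by rewrite lg lh opprD.
- exact: bounded_byN.
- exact: bounded_byN.
- exact: linear_atN.
Qed.

Lemma state_sub g h : bounded_by v g -> bounded_by v h -> linear_at s g ->
  linear_at s h -> s (g - h) = s g - s h.
Proof. by move=> bg bh lg lh; rewrite state_add ?lh //; apply: bounded_byN. Qed.

Lemma state_ge0 g : bounded_by v g -> 0 <= g -> 0 <= s g.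
Proof.
move=> bg g0; rewrite -(state_0 hs); apply: (state_le hs) => //.
by exists 0%N; rewrite mulr0n oppr0.
Qed.

End StateTheory.

(** Split into countably many requests, one for each [m]; for a decreasing [c] this amounts to
    convergence of the values to 0. *)
Definition preserves (s : G -> R) (c : nat -> G) :=
  forall m, exists k, s (c k) <= m.+1%:R^-1.

Lemma generic_state v b (e : nat -> G) (c : nat -> nat -> G) :
  0 <= v -> bounded_by v b -> ~ 0 <= b ->
  (forall i, bounded_by v (e i)) -> (forall i k, bounded_by v (c i k)) ->
  (forall i, decr_to0 (c i)) ->
  exists s : G -> R, [/\ state v s, s b < 0, forall i, linear_at s (e i) &
    forall i, preserves s (c i)].
Proof.
move=> v0 bb b0 be bc dc; have [K [vb _]] := bb.
(* The start [y] lies above [b *+ M + v]; the spare [v] forces the value at [b] to be at most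
   [-1 / M], hence strictly negative. Being above [- v], it also puts [- v] into the cut. *)
have [M M0 bM0] := not_ge0_shift v0 b0.
have [|y [bMy vy y0]] := @not_ge0_truncate v (b *+ M + v) (K * M) v0 _ bM0.
  apply: (po_le_by hG (po_leD hG (po_leMn hG M vb) v0)).
  by rewrite mulrnA mulNrn; zmod.
pose lower g := exists K, - (v *+ K) <= g.
(* Stage [j] serves the request coded by [j]: compare [e i] with [p / q], or make the value at some
   [c i k] at most [1 / (m + 1)]. *)
pose task (j : nat) : option ((nat * nat * int) + (nat * nat)) := unpickle j.
pose decided j y' := match task j with
  | Some (inl (i, q, p)) => e i *+ q - v *~ p <= y' \/ - (e i *+ q - v *~ p) - v <= y'
  | Some (inr (i, m)) => exists k, c i k *+ m.+1 - v <= y'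
  | None => True end.
have step j z : lower z /\ ~ 0 <= z -> exists2 z', lower z' /\ ~ 0 <= z' &
    (exists2 L, (0 < L)%N & z *+ L <= z') /\ decided j z'.
  move=> [[L vz] z0]; rewrite /decided.
  have lowerMn m z' : z *+ m <= z' -> lower z'.
    move=> zz'; exists (L * m)%N; apply: le_trans zz'.
    by rewrite mulrnA -mulNrn; apply: po_leMn.
  case: (task j) => [[[[i q] p]|[i m]]|]; last first.
  - by exists z; [split=> //; exists L|split=> //; exists 1%N].
  - have [k [z' [zz' cz' z'0]]] := not_ge0_decr_to0 v0 vz (decr_to0Mn hG m.+1 (dc i)) z0.
    exists z'; first by split=> //; apply: (lowerMn 1%N).
    by split; [exists 1%N|exists k].
  - have [K' [vg gv]] := bounded_byD (bounded_byMn q (be i)) (bounded_byN (bounded_byMz p v0)).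
    have [m [z' [m0 zz' gz' z'0]]] := not_ge0_decide v0 vz vg gv z0.
    by exists z'; split=> //; [apply: lowerMn zz'|exists m].
have [|f [f0 Pf Qf]] := @invariant_choice _ _ _ y _ step.
  by split=> //; exists 1%N.
have chain j l : exists2 L, (0 < L)%N & f j *+ L <= f (j + l)%N.
  elim: l => [|l [L L0 fL]]; first by exists 1%N; rewrite ?addn0.
  have [[L' L'0 fL'] _] := Qf (j + l)%N; rewrite addnS; exists (L * L')%N.
    by rewrite muln_gt0 L0.
  by apply: le_trans fL'; rewrite mulrnA; apply: po_leMn.
(* Multiples are allowed on both sides because a stage dominates its predecessors only up to a
   multiple; [unperforated] keeps 0 out. *)
pose N g := exists j M K, [/\ (0 < M)%N, (0 < K)%N & g *+ M <= f j *+ K].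
have Nle g h : g <= h -> N h -> N g.
  move=> gh [j [m [k [m0 k0 hf]]]]; exists j, m, k; split=> //.
  by apply: le_trans hf; apply: po_leMn.
have Nf j g : g <= f j -> N g by exists j, 1%N, 1%N.
have Nadd g h : N g -> N h -> N (g + h).
  have wlog1 j l m m' k k' g' h' : (0 < m)%N -> (0 < k)%N -> (0 < m')%N -> (0 < k')%N ->
      g' *+ m <= f j *+ k -> h' *+ m' <= f (j + l)%N *+ k' -> N (g' + h').
    move=> m0 k0 m'0 k'0 gm hm; have [L L0 fL] := chain j l.
    exists (j + l)%N, (m * m' * L)%N, (k * m' + k' * (m * L))%N.
    split; first by rewrite !muln_gt0 m0 m'0.
      by rewrite addn_gt0 !muln_gt0 k0 m'0.
    rewrite mulrnDl [X in _ <= X]mulrnDr; apply: po_leD => //.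
      have -> : (m * m' * L = m * (L * m'))%N by rewrite -mulnA [(m' * L)%N]mulnC.
      rewrite mulrnA; apply: le_trans (po_leMn hG _ gm) _.
      rewrite -!mulrnA [(k * (L * m'))%N]mulnA [(k * L)%N]mulnC -mulnA mulrnA.
      exact: po_leMn.
    have -> : (m * m' * L = m' * (m * L))%N by rewrite [(m * m')%N]mulnC -mulnA.
    by rewrite mulrnA [f _ *+ _]mulrnA; apply: po_leMn.
  move=> [j [m [k [m0 k0 gf]]]] [j' [m' [k' [m'0 k'0 hf]]]].
  have [jj|/ltnW jj] := leqP j j'.
    by apply: (wlog1 j (j' - j)%N m m' k k') => //; rewrite subnKC.
  by rewrite addrC; apply: (wlog1 j' (j - j')%N m' m k' k) => //; rewrite subnKC.
have N0 : ~ N 0.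
  move=> [j [m [k [m0 k0]]]]; rewrite mul0rn => /(unperforated k0).
  by case: (Pf j).
have Nv : N (- v) by apply: (Nf 0%N); rewrite f0.
exists (cut v N); split.
- exact: state_cut.
- apply: (@le_lt_trans _ _ ((-1)%:~R / M%:R)).
    apply: (cut_le v0 Nle Nadd N0 Nv) => //.
    by apply: (Nf 0%N); rewrite f0; apply: le_trans bMy; rewrite mulrNz mulr1z opprK.
  by rewrite mulN1r oppr_lt0 invr_gt0 ltr0n.
- move=> i; apply: (cut_additive v0 Nle Nadd N0 Nv) => // q p.
  have := (Qf (pickle (inl (i, q, p) : (nat * nat * int) + (nat * nat)))).2.
  by rewrite /decided /task pickleK => -[h|h]; [left|right]; apply: Nf h.
- move=> i m.
  have := (Qf (pickle (inr (i, m) : (nat * nat * int) + (nat * nat)))).2.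
  rewrite /decided /task pickleK => -[k h]; exists k.
  have := @cut_le v N v0 Nle Nadd N0 Nv (c i k) m.+1 1 (bc i k) isT.
  by rewrite mul1r; apply; apply: Nf h.
Qed.

End InterpolationGroup.

(** * Volumes of boxes *)

Section BoxVolume.
Variables (n : nat) (T : Type).
Implicit Types (t l r : 'I_n -> T) (i : 'I_n) (S : {set 'I_n}).

Definition upd t i c : 'I_n -> T := fun j => if j == i then c else t j.

Definition mix S l r : 'I_n -> T := fun i => if i \in S then l i else r i.

Definition signed (K : zmodType) (b : bool) (x : K) := if b then - x else x.

(** Inclusion-exclusion over the corners. The coordinate type stays abstract, since rational,
    extended rational and real boxes all occur. *)
Definition vol (K : zmodType) l r (f : ('I_n -> T) -> K) :=
  \sum_(S : {set 'I_n}) signed (odd #|S|) (f (mix S l r)).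

Lemma upd_id t i : upd t i (t i) = t.
Proof. by apply: funext => j; rewrite /upd; case: eqP => [->|]. Qed.

Lemma upd_upd t i c d : upd (upd t i c) i d = upd t i d.
Proof. by apply: funext => j; rewrite /upd; case: eqP. Qed.

Lemma upd_same t i c : upd t i c i = c.
Proof. by rewrite /upd eqxx. Qed.

Lemma mix_notin S l r i : i \notin S -> mix S l r i = r i.
Proof. by rewrite /mix => /negPf ->. Qed.

Lemma mixU1 S l r i : mix (i |: S) l r = upd (mix S l r) i (l i).
Proof.
by apply: funext => j; rewrite /mix /upd !inE; case: eqP => [->|].
Qed.

Lemma mix_updr S l r i c : i \notin S -> mix S l (upd r i c) = upd (mix S l r) i c.
Proof.
move=> iS; apply: funext => j; rewrite /mix /upd.
by case: eqP => // ->; rewrite (negPf iS).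
Qed.

Lemma mix_updl S l r i c : i \notin S -> mix S (upd l i c) r = mix S l r.
Proof.
move=> iS; apply: funext => j; rewrite /mix /upd.
by case: (eqVneq j i) => // ->; rewrite (negPf iS).
Qed.

Variable K : zmodType.
Implicit Types (f g : ('I_n -> T) -> K).

Lemma signedD b (x y : K) : signed b (x + y) = signed b x + signed b y.
Proof. by case: b; rewrite /= ?opprD. Qed.

Lemma signedN b (x : K) : signed b (- x) = - signed b x.
Proof. by case: b. Qed.

Lemma signed0 b : signed b (0 : K) = 0.
Proof. by case: b; rewrite /= ?oppr0. Qed.

Lemma signedC b (x : K) : signed (~~ b) x = - signed b x.
Proof. by case: b; rewrite /= ?opprK. Qed.

Lemma vol_pair i l r f :
  vol l r f = \sum_(S : {set 'I_n} | i \notin S)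
    signed (odd #|S|) (f (mix S l r) - f (upd (mix S l r) i (l i))).
Proof.
rewrite /vol (bigID (fun S : {set 'I_n} => i \in S)) /= addrC.
rewrite [X in _ + X](reindex_onto (fun S : {set 'I_n} => i |: S) (fun S => S :\ i)) /=; last first.
  by move=> S iS; rewrite finset.setD1K.
rewrite [X in _ + X](eq_bigl (fun S : {set 'I_n} => i \notin S)); last first.
  move=> S; rewrite finset.setU11 /=; apply/eqP/idP => [<-|iS]; first by rewrite !inE eqxx.
  by rewrite finset.setU1K.
rewrite -big_split; apply: eq_bigr => S iS.
by rewrite cardsU1 iS /= signedC mixU1 signedD signedN.
Qed.

Lemma vol_split i c l r f :
  vol l r f = vol l (upd r i c) f + vol (upd l i c) r f.
Proof.
rewrite !(vol_pair i) -big_split; apply: eq_bigr => S iS /=.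
rewrite -signedD mix_updr // mix_updl // !upd_upd upd_same; congr signed; zmod.
Qed.

Lemma vol_const i l r f :
  (forall t, f (upd t i (l i)) = f (upd t i (r i))) -> vol l r f = 0.
Proof.
move=> fi; rewrite (vol_pair i) big1 // => S iS.
by rewrite fi -(mix_notin l r iS) upd_id subrr signed0.
Qed.

Lemma volB l r f g : vol l r (fun t => f t - g t) = vol l r f - vol l r g.
Proof.
rewrite /vol -sumrB; apply: eq_bigr => S _.
by rewrite signedD signedN.
Qed.

Lemma vol_sum (I : finType) l r (f : I -> ('I_n -> T) -> K) :
  vol l r (fun t => \sum_i f i t) = \sum_i vol l r (f i).
Proof.
rewrite /vol exchange_big; apply: eq_bigr => S _.
by rewrite (big_morph _ (@signedD _) (signed0 _)).
Qed.

Lemma vol_morph (K' : zmodType) (phi : K -> K') l r f :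
  {morph phi : x y / x - y} -> phi (vol l r f) = vol l r (phi \o f).
Proof.
move=> phiB; have phi0 : phi 0 = 0 by rewrite -(subrr 0) phiB subrr.
have phiN x : phi (- x) = - phi x by rewrite -[in LHS]sub0r phiB phi0 sub0r.
have phiD x y : phi (x + y) = phi x + phi y by rewrite -[in LHS](opprK y) phiB phiN opprK.
rewrite /vol (big_morph _ phiD phi0); apply: eq_bigr => S _.
by case: (odd _) => //=; rewrite phiN.
Qed.

End BoxVolume.

Lemma Delta_allE (R : realType) (n : nat) (K : porderZmodType)
    (a b t : 'rV[R]_n) (F : 'rV[R]_n -> K) :
  Delta_all a b F t = vol (a 0) (b 0) (fun x => F (\row_j x j)).
Proof.
(* Induction on the coordinates already differenced: a new coordinate [i] doubles the sum, the
   subsets containing [i] coming from its lower end. *)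
have key s : uniq s -> forall t,
    foldr (fun i g => Delta i (a 0 i) (b 0 i) g) F s t =
    \sum_(S : {set 'I_n} | S \subset s) signed (odd #|S|)
      (F (\row_j if j \in s then mix S (a 0) (b 0) j else t 0 j)).
  elim: s => [_|i s IHs /= /andP[is_ us]] u /=.
    rewrite (big_pred1 finset.set0) => [|S]; last first.
      rewrite /=; apply/fintype.subsetP/eqP => [S0|-> x]; last by rewrite inE.
      by apply/setP => x; rewrite inE; apply/negP => /S0.
    by rewrite cards0 /=; congr F; apply/rowP => j; rewrite mxE.
  rewrite /Delta !IHs // [RHS](bigID (fun S : {set 'I_n} => i \in S)) /= addrC.
  congr (_ + _).
    apply: eq_big => [S|S Ss].
      apply/fintype.subsetP/andP => [Ss|[/fintype.subsetP Ss iS] j jS].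
        split; last by apply: contra is_; apply: Ss.
        by apply/fintype.subsetP => j /Ss; rewrite inE orbC => ->.
      have := Ss _ jS; rewrite inE => /orP[/eqP ji|//].
      by rewrite -ji jS in iS.
    have iS : i \notin S by apply: contra is_; apply: (fintype.subsetP Ss).
    congr (signed _ (F _)); apply/rowP => j; rewrite !mxE inE.
    by case: (eqVneq j i) => //= ->; rewrite (negPf is_) (mix_notin _ _ iS).
  rewrite -sumrN [RHS](reindex_onto (fun S : {set 'I_n} => i |: S) (fun S => S :\ i)) /=; last first.
    by move=> S /andP[_ iS]; rewrite finset.setD1K.
  apply: eq_big => [S|S Ss].
    apply/idP/andP => [Ss|[/andP[Ss _] /eqP Si]].
      have iS : i \notin S by apply: contra is_; apply: (fintype.subsetP Ss).
      rewrite finset.setU11 finset.setU1K //; split=> //; rewrite andbT.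
      by apply/fintype.subsetP => j; rewrite !inE => /orP[->//|/(fintype.subsetP Ss) ->]; rewrite orbT.
    have iS : i \notin S by rewrite -Si !inE eqxx.
    apply/fintype.subsetP => j jS; have := fintype.subsetP Ss j; rewrite !inE jS orbT => /(_ isT).
    by case/orP => // /eqP ji; rewrite -ji jS in iS.
  have iS : i \notin S by apply: contra is_; apply: (fintype.subsetP Ss).
  rewrite cardsU1 iS /= signedC; congr (- signed _ (F _)); apply/rowP => j.
  rewrite !mxE inE mixU1 /upd.
  by case: (eqVneq j i) => //= ->; rewrite (negPf is_).
rewrite /Delta_all key ?enum_uniq //.
rewrite /vol; apply: eq_big => S; first by apply/fintype.subsetP => j; rewrite mem_enum.
move=> _; congr (signed _ (F _)); apply/rowP => j.
by rewrite !mxE mem_enum.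
Qed.

(** The box is shrunk one coordinate at a time; each time two slabs of non-negative volume are cut
    off. *)
Lemma vol_sub (n : nat) (d : Order.disp_t) (T : porderType d) (K : porderZmodType)
    (f : ('I_n -> T) -> K) (l r l' r' : 'I_n -> T) :
  po_group K ->
  (forall l r : 'I_n -> T, (forall i, l i <= r i)%O -> 0 <= vol l r f) ->
  (forall i, l i <= l' i)%O -> (forall i, l' i <= r' i)%O -> (forall i, r' i <= r i)%O ->
  vol l' r' f <= vol l r f.
Proof.
move=> hK f0 ll lr rr.
pose w (u u' : 'I_n -> T) (s : seq 'I_n) j := if j \in s then u' j else u j.
have wE (u u' : 'I_n -> T) : u' = w u u' (enum 'I_n).
  by apply: funext => j; rewrite /w mem_enum.
rewrite (wE l l') (wE r r'); elim: (enum _) => [|i s IHs]; first by rewrite (_ : w l l' [::] = l).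
apply: le_trans IHs.
have wU (u u' : 'I_n -> T) : w u u' (i :: s) = upd (w u u' s) i (u' i).
  by apply: funext => j; rewrite /w /upd inE; case: eqP => // ->.
have wlr j : (w l l' s j <= l' j)%O /\ (r' j <= w r r' s j)%O.
  by rewrite /w; case: ifP.
rewrite !wU (vol_split i (l' i) (w l l' s)) (vol_split i (r' i) (upd _ _ _) (w r r' s)).
have h1 : 0 <= vol (w l l' s) (upd (w r r' s) i (l' i)) f.
  apply: f0 => j; rewrite /upd; case: eqP => [->|_]; first by case: (wlr i).
  by have [a b] := wlr j; apply: le_trans a (le_trans (lr j) b).
have h2 : 0 <= vol (upd (upd (w l l' s) i (l' i)) i (r' i)) (w r r' s) f.
  rewrite upd_upd; apply: f0 => j; rewrite /upd; case: eqP => [->|_]; first by case: (wlr i).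
  by have [a b] := wlr j; apply: le_trans a (le_trans (lr j) b).
by apply: (po_le_by hK (po_leD hK h1 h2)); zmod.
Qed.

(** * Random vectors with a given distribution function *)

Section BisectionTree.
Variables (R : realType) (n : nat) (d : Order.disp_t) (T : orderType d).
Variables (f : ('I_n -> T) -> R) (l0 r0 : 'I_n -> T) (gen : nat -> 'I_n * T).
Hypothesis f_vol : forall l r : 'I_n -> T, (forall i, l i <= r i)%O -> 0 <= vol l r f.
Hypothesis l0r0 : forall i, (l0 i <= r0 i)%O.

Local Notation mu := (@lebesgue_measure R).

(* The word [w] lists, latest first, on which side of the first [size w]
   hyperplanes we are; [nlo w] and [nhi w] are the corners of the corresponding
   box and [pos w] is the left end of an interval of length its volume. *)
Record node := Node { nlo : 'I_n -> T; nhi : 'I_n -> T; npos : R }.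

(** The hyperplane is moved into the box, so that one that misses the box yields a degenerate half
    of volume 0 and every step is a bisection. *)
Definition cut_coord (b : node) (k : nat) : T :=
  let: (i, c) := gen k in Order.max (nlo b i) (Order.min (nhi b i) c).

Definition left_hi (b : node) k := upd (nhi b) (gen k).1 (cut_coord b k).
Definition right_lo (b : node) k := upd (nlo b) (gen k).1 (cut_coord b k).

Fixpoint walk (w : seq bool) : node :=
  match w with
  | [::] => Node l0 r0 0
  | e :: w' =>
      let b := walk w' in
      let k := size w' in
      if e then Node (nlo b) (left_hi b k) (npos b)
      else Node (right_lo b k) (nhi b) (npos b + vol (nlo b) (left_hi b k) f)
  end.

Definition mass w := vol (nlo (walk w)) (nhi (walk w)) f.

Definition cell w : set R := [set` `[npos (walk w), npos (walk w) + mass w[].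

Definition side k : set R := [set x | exists2 w, size w = k & cell (true :: w) x].

Lemma cut_coordP (b : node) k : (nlo b (gen k).1 <= nhi b (gen k).1)%O ->
  (nlo b (gen k).1 <= cut_coord b k <= nhi b (gen k).1)%O.
Proof.
rewrite /cut_coord; case: (gen k) => i c /= lr.
by rewrite le_max lexx /= ge_max lr ge_min lexx.
Qed.

Lemma walk_le w i : (nlo (walk w) i <= nhi (walk w) i)%O.
Proof.
elim: w i => [|e w IHw] i //=.
have /andP[h1 h2] := @cut_coordP (walk w) (size w) (IHw _).
by case: e => /=; rewrite /left_hi /right_lo /upd; case: eqP => [->|_].
Qed.

Lemma mass_ge0 w : 0 <= mass w.
Proof. by apply: f_vol => i; apply: walk_le. Qed.

Lemma mass_split w : mass w = mass (true :: w) + mass (false :: w).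
Proof. exact: vol_split. Qed.

Lemma cell_split w : cell w = cell (true :: w) `|` cell (false :: w).
Proof.
have e := mass_split w; have h1 := mass_ge0 (true :: w); have h2 := mass_ge0 (false :: w).
have -> : cell (false :: w) = [set` `[npos (walk w) + mass (true :: w),
   npos (walk w) + mass (true :: w) + mass (false :: w)[] by [].
have -> : cell (true :: w) = [set` `[npos (walk w), npos (walk w) + mass (true :: w)[] by [].
rewrite /cell; move: (mass w) (mass (true :: w)) (mass (false :: w)) (npos _) e h1 h2.
move=> m m1 m2 p -> h1 h2; rewrite addrA; apply/seteqP; split=> x /=; rewrite !in_itv /=.
  move=> /andP[px xp]; have [h|h] := ltP x (p + m1); [left|right].
    by rewrite px.
  by rewrite xp.
by case=> /andP[h3 h4]; apply/andP; split; lra.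
Qed.

Lemma cell_disjoint w : cell (true :: w) `&` cell (false :: w) = set0.
Proof.
rewrite /cell; apply/seteqP; split=> x //; rewrite /setI /= !in_itv /=.
move=> -[/andP[_ h] /andP[h' _]].
by have := lt_le_trans h h'; rewrite ltxx.
Qed.

Lemma measurable_cell w : measurable (cell w).
Proof. exact: measurable_itv. Qed.

Lemma mu_cell w : mu (cell w) = (mass w)%:E.
Proof.
rewrite lebesgue_measure_itv /= lte_fin ltrDl; have := mass_ge0 w.
rewrite le_eqVlt => /orP[/eqP<-|m0]; first by rewrite ltxx.
by rewrite m0 -EFinB addrAC subrr add0r.
Qed.

Lemma cell_cons e w : cell (e :: w) `<=` cell w.
Proof. by move=> x xe; rewrite cell_split; case: e xe; [left|right]. Qed.

Lemma cell_drop j w : cell w `<=` cell (drop j w).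
Proof.
elim: w j => [|e w IHw] [|j] //= x /cell_cons; exact: IHw.
Qed.

Lemma cell_inj w w' x : size w = size w' -> cell w x -> cell w' x -> w = w'.
Proof.
elim: w w' => [|e w IHw] [|e' w'] //= [ww'] xw xw'.
have eqw : w = w' by apply: IHw ww' _ _; [apply: cell_cons xw|apply: cell_cons xw'].
move: xw xw'; rewrite eqw; case: e e' => -[] // xw xw'.
  by have := cell_disjoint w' => /seteqP[/(_ x) /(_ (conj xw xw'))].
by have := cell_disjoint w' => /seteqP[/(_ x) /(_ (conj xw' xw))].
Qed.

Lemma cell_exists N x : cell [::] x -> exists2 w, size w = N & cell w x.
Proof.
move=> x0; elim: N => [|N [w wN]]; first by exists [::].
by rewrite cell_split => -[xw|xw]; [exists (true :: w)|exists (false :: w)] => //=; rewrite wN.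
Qed.

Lemma side_sub k : side k `<=` cell [::].
Proof. by move=> x [w _ /(@cell_drop (size w).+1)]; rewrite /= drop_size. Qed.

Lemma measurable_side k : measurable (side k).
Proof.
have -> : side k = \bigcup_w if size w == k then cell (true :: w) else set0.
  apply/seteqP; split=> x [w wk xw]; first by exists w; rewrite ?wk ?eqxx.
  by move: xw; case: eqP => // ? ?; exists w.
apply: countable_bigcupT_measurable => [|w]; first exact: countableP.
by case: ifP => _; [exact: measurable_cell|exact: measurable0].
Qed.

Lemma walk_drop_le j w i : (nlo (walk (drop j w)) i <= nlo (walk w) i)%O /\
  (nhi (walk w) i <= nhi (walk (drop j w)) i)%O.
Proof.
elim: w j => [|e w IHw] [|j] //=; have [h1 h2] := IHw j.
have /andP[h3 h4] := @cut_coordP (walk w) (size w) (walk_le w _).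
split; [apply: le_trans h1 _|apply: le_trans h2]; case: e => //=;
  by rewrite /right_lo /left_hi /upd; case: eqP => // ->.
Qed.

(** Since words list the latest choice first, the choice made at step [k] is the head of the suffix
    of length [k.+1]. *)
Lemma digitP (w : seq bool) k : (k < size w)%N ->
  exists e w', drop (size w - k.+1) w = e :: w' /\ size w' = k.
Proof.
move=> kw; have : size (drop (size w - k.+1) w) = k.+1.
  by rewrite size_drop subKn.
by case: (drop _ w) => [|e w'] //= [wk]; exists e, w'.
Qed.

Lemma digit_side w k e w' x : drop (size w - k.+1) w = e :: w' -> size w' = k ->
  cell w x -> side k x <-> e.
Proof.
move=> dw wk /(@cell_drop (size w - k.+1)); rewrite dw => xe.
split=> [[w2 wk2 xw2]|et]; last by exists w' => //; move: xe; rewrite et.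
have ee : size (e :: w') = size (true :: w2) by rewrite /= wk wk2.
by have [] := cell_inj ee xe xw2.
Qed.

(** The degenerate case arises when step [k] chose a half that the hyperplane does not cut off;
    otherwise the box is on the expected side, and later bisections only shrink it. *)
Lemma digit_bound w k e w' i c : drop (size w - k.+1) w = e :: w' -> size w' = k ->
  gen k = (i, c) -> nlo (walk w) i = nhi (walk w) i \/
  if e then (nhi (walk w) i <= c)%O else (c <= nlo (walk w) i)%O.
Proof.
move=> dw wk gk; have [] := @walk_drop_le (size w - k.+1) w i; rewrite dw /=.
have lr := walk_le w i; have lr' := walk_le w' i.
have gw : gen (size w') = (i, c) by rewrite wk.
case: e dw => _ /=; rewrite /left_hi /right_lo /cut_coord gw /= upd_same => lo hi.
  have [minc|minc] := leP (nlo (walk w') i) (Order.min (nhi (walk w') i) c).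
    right; apply: le_trans hi _; rewrite max_r //.
    by rewrite ge_min lexx orbT.
  left; apply: le_anti; rewrite lr /=; apply: le_trans hi _.
  by rewrite max_l // ltW.
have [cn|cn] := leP c (nhi (walk w') i).
  by right; apply: le_trans lo; rewrite le_max min_r // lexx orbT.
left; apply: le_anti; rewrite lr /=; apply: le_trans hi _.
by apply: le_trans lo; rewrite le_max min_l ?lexx ?orbT // ltW.
Qed.

(** A point left of [c] but not of [c'] would lie in a cell whose box is degenerate in direction
    [i]; such a box has mass 0 and its half-open cell is empty. *)
Lemma side_mono k k' i c c' : gen k = (i, c) -> gen k' = (i, c') -> (c <= c')%O ->
  side k `<=` side k'.
Proof.
move=> gk gk' cc' x xk; apply: contrapT => xk'.
have [w wN xw] := cell_exists (maxn k k').+1 (side_sub xk).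
have kw : (k < size w)%N by rewrite wN ltnS leq_maxl.
have kw' : (k' < size w)%N by rewrite wN ltnS leq_maxr.
have [e [w1 [dw wk]]] := digitP kw; have [e' [w1' [dw' wk']]] := digitP kw'.
have et : e = true by apply/(digit_side dw wk xw).
have e't : e' = false by apply/negP => /(digit_side dw' wk' xw).
have deg : nlo (walk w) i = nhi (walk w) i.
  have [//|hi] := digit_bound dw wk gk; have [//|lo] := digit_bound dw' wk' gk'.
  rewrite et e't in hi lo; apply: le_anti; rewrite walk_le /=.
  by apply: le_trans hi (le_trans cc' lo).
have m0 : mass w = 0 by apply: (@vol_const _ _ _ i) => t; rewrite deg.
by move: xw; rewrite /cell m0 addr0 /= in_itv /= => /andP[h]; rewrite ltNge h.
Qed.

(* [f (min t c)] is the distribution function of the restriction to the orthant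
   below [c]. *)
Lemma mu_sides (k : 'I_n -> nat) (c : 'I_n -> T) : (forall i, gen (k i) = (i, c i)) ->
  mu (cell [::] `&` [set x | forall i, side (k i) x]) =
  (vol l0 r0 (fun t => f (fun i => Order.min (t i) (c i))))%:E.
Proof.
move=> gk; set E := [set x | _].
have mE : measurable E.
  have -> : E = \bigcap_i side (k i) by apply/seteqP; split=> x h i //=; apply: h.
  by apply: fin_bigcap_measurable => // i _; apply: measurable_side.
pose g t := f (fun i => Order.min (t i) (c i)).
(* Here [j] bounds the number of bisections left until all the choices [k i] have been made. *)
suff key j w : (\max_i (k i).+1 <= size w + j)%N ->
    mu (cell w `&` E) = (vol (nlo (walk w)) (nhi (walk w)) g)%:E.
  by rewrite (key (\max_i (k i).+1)%N [::]).
elim: j w => [|j IHj] w; last first.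
  rewrite addnS -addSn => wj; rewrite cell_split setIUl measureU //=.
  - by rewrite !IHj // -EFinD -vol_split.
  - by apply: measurableI => //; apply: measurable_cell.
  - by apply: measurableI => //; apply: measurable_cell.
  - by rewrite setIACA cell_disjoint set0I.
rewrite addn0 => wj.
have kw i : (k i < size w)%N by apply: leq_trans wj; apply: (leq_bigmax i).
(* If some choice went right, the cell misses [E] and the restricted function does not depend on
   coordinate [i] over the box. If all went left, the restriction changes nothing. *)
have [[i [w' [dw wk]]]|alltrue] := pselect (exists i w',
    drop (size w - (k i).+1) w = false :: w' /\ size w' = k i).
  have -> : cell w `&` E = set0.
    apply/seteqP; split=> x //= [xw /(_ i)].
    by move/(digit_side dw wk xw).
  rewrite measure0 (@vol_const _ _ _ i) // => t; rewrite /g.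
  have [->//|/= ci] := digit_bound dw wk (gk i).
  congr f; apply: funext => j; rewrite /upd; case: eqP => // ->.
  by rewrite !min_r // (le_trans ci) // walk_le.
have dig i : exists w', drop (size w - (k i).+1) w = true :: w' /\ size w' = k i.
  have [[] [w' [dw wk]]] := digitP (kw i); first by exists w'.
  by exfalso; apply: alltrue; exists i, w'.
have -> : cell w `&` E = cell w.
  apply/seteqP; split=> x; first by case.
  move=> xw; split=> // i; have [w' [dw wk]] := dig i.
  by apply/(digit_side dw wk xw).
rewrite mu_cell; congr EFin.
have [[i deg]|ndeg] := pselect (exists i, nlo (walk w) i = nhi (walk w) i).
  by rewrite /mass !(@vol_const _ _ _ i) // => t; rewrite deg.
rewrite /mass /vol; apply: eq_bigr => S _; congr signed; rewrite /g; congr f.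
apply: funext => i; rewrite min_l //.
have [w' [dw wk]] := dig i; have [deg|/= hi] := digit_bound dw wk (gk i).
  by exfalso; apply: ndeg; exists i.
by apply: le_trans hi; rewrite /mix; case: ifP => // _; apply: walk_le.
Qed.

End BisectionTree.

Lemma fin_nat_bound (n : nat) (R : archiRealDomainType) (x : 'I_n -> R) :
  exists M : nat, forall i, `|x i| <= M%:R.
Proof.
exists (\sum_j Num.bound `|x j|)%N => i.
apply: le_trans (ltW (archi_boundP (normr_ge0 (x i)))) _.
by rewrite ler_nat (bigD1 i) //= leq_addr.
Qed.

Lemma lebesgue_measureDI (R : realType) (B C : set (measurableTypeR R)) :
  measurable B -> measurable C ->
  lebesgue_measure B = (lebesgue_measure (B `\` C) + lebesgue_measure (B `&` C))%E.
Proof. exact: measureDI. Qed.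

(** * Distribution functions on the rationals, extended to infinite coordinates *)

Section ExtendedDistribution.
Variables (R : realType) (n : nat) (phi : ('I_n -> rat) -> R).
Hypothesis phi_vol : forall l r : 'I_n -> rat, (forall i, l i <= r i) -> 0 <= vol l r phi.
Hypothesis phi_mono : forall s t : 'I_n -> rat, (forall i, s i <= t i) -> phi s <= phi t.
Hypothesis phi_ge0 : forall t, 0 <= phi t.
Hypothesis phi_bot : forall i, phi (upd (fun=> k%:R) i (- k%:R)) @[k --> \oo] --> (0 : R).
Hypothesis phi_top : phi (fun=> k%:R) @[k --> \oo] --> (1 : R).

Definition clamp (k : nat) (x : \bar rat) : rat :=
  match x with
  | EFin q => q
  | +oo%E => k%:R
  | -oo%E => - k%:R
  end.

Definition ext_phi (t : 'I_n -> \bar rat) : R := limn (fun k => phi (clamp k \o t)).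

Lemma phi_le1 t : phi t <= 1.
Proof.
have [M tM] := fin_nat_bound t.
apply: le_trans (_ : phi (fun=> M%:R) <= _).
  by apply: phi_mono => i; apply: le_trans (ler_norm _) (tM i).
rewrite -(cvg_lim _ phi_top) //; apply: nondecreasing_cvgn_le; last by apply/cvg_ex; exists 1.
by move=> k l kl; apply: phi_mono => i; rewrite ler_nat.
Qed.

Lemma clamp_bound (t : 'I_n -> \bar rat) :
  exists M : nat, forall k i, (M <= k)%N -> - k%:R <= clamp k (t i) <= k%:R.
Proof.
have [M tM] := fin_nat_bound (fun i => clamp 0 (t i)).
exists M => k i Mk; have := tM i; have : (M%:R : rat) <= k%:R by rewrite ler_nat.
have : (0 : rat) <= k%:R by [].
case: (t i) => [q||] //=; rewrite ?ler_norml; lra.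
Qed.

Lemma phi_clamp_bot t i : t i = -oo%E -> phi (clamp k \o t) @[k --> \oo] --> (0 : R).
Proof.
move=> ti; have [M tM] := clamp_bound t.
apply: (@squeeze_cvgr _ _ _ _ (fun=> 0) (fun k => phi (upd (fun=> k%:R) i (- k%:R)))).
- near=> k; rewrite phi_ge0 /=; apply: phi_mono => j; rewrite /upd /=.
  have Mk : (M <= k)%N by near: k; apply: nbhs_infty_ge.
  by case: eqP => [->|_]; [rewrite ti|have /andP[] := tM k j Mk].
- exact: cvg_cst.
- exact: phi_bot.
Unshelve. all: by end_near. Qed.

(** With a coordinate [-oo] the sequence need not be monotone, but it is squeezed to 0 by [phi_bot];
    without one it is non-decreasing and bounded by 1. *)
Lemma phi_clamp_cvg t : phi (clamp k \o t) @[k --> \oo] --> ext_phi t.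
Proof.
have [[i ti]|noi] := pselect (exists i, t i = -oo%E).
  by apply/cvg_ex; exists 0; apply: phi_clamp_bot ti.
apply: nondecreasing_is_cvgn; last by exists 1 => _ [k _ <-]; apply: phi_le1.
move=> k l kl; apply: phi_mono => i /=; case E : (t i) => [q||] //=.
  by rewrite ler_nat.
by exfalso; apply: noi; exists i.
Qed.

Lemma vol_cvg (T : Type) (g : nat -> ('I_n -> T) -> R) (h : ('I_n -> T) -> R) l r :
  (forall t, g k t @[k --> \oo] --> h t) -> vol l r (g k) @[k --> \oo] --> vol l r h.
Proof.
move=> gh; rewrite /vol; elim: (index_enum _) => [|S s IHs].
  rewrite big_nil (_ : (fun _ => _) = fun=> 0); first exact: cvg_cst.
  by apply: funext => k; rewrite big_nil.
rewrite big_cons (_ : (fun _ => _) = fun k => signed (odd #|S|) (g k (mix S l r)) +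
  \sum_(S <- s) signed (odd #|S|) (g k (mix S l r))); last first.
  by apply: funext => k; rewrite big_cons.
apply: cvgD => //; case: (odd _) => //=; exact: cvgN.
Qed.

Lemma ext_phi_vol (l r : 'I_n -> \bar rat) : (forall i, l i <= r i)%O -> 0 <= vol l r ext_phi.
Proof.
move=> lr; have cv := vol_cvg (l := l) (r := r) phi_clamp_cvg.
rewrite -(cvg_lim _ cv) //; apply: limr_ge; first by apply/cvg_ex; eexists; exact: cv.
have [M lM] := clamp_bound l; have [M' rM] := clamp_bound r.
near=> k.
have Mk : (M <= k)%N by near: k; apply: nbhs_infty_ge.
have Mk' : (M' <= k)%N by near: k; apply: nbhs_infty_ge.
rewrite (_ : vol _ _ _ = vol (clamp k \o l) (clamp k \o r) phi); last first.
  apply: eq_bigr => S _; congr (signed _ (phi _)); apply: funext => i /=.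
  by rewrite /mix; case: ifP.
apply: phi_vol => i /=; have := lr i.
have /andP[l1 l2] := lM k i Mk; have /andP[r1 r2] := rM k i Mk'.
by case: (l i) l1 l2 => [q||] /= l1 l2; case: (r i) r1 r2 => [q'||].
Unshelve. all: by end_near. Qed.

Lemma ext_phi_fin (c : 'I_n -> rat) : ext_phi (fun i => (c i)%:E) = phi c.
Proof. by apply: cvg_lim => //; apply: (@cvg_cst _ (phi c)). Qed.

Lemma ext_phi_top : ext_phi (fun=> +oo%E) = 1.
Proof. exact: (cvg_lim _ phi_top). Qed.

Lemma ext_phi_bot t i : t i = -oo%E -> ext_phi t = 0.
Proof. by move=> ti; apply: cvg_lim => //; apply: phi_clamp_bot ti. Qed.

Lemma vol_ext (g : ('I_n -> \bar rat) -> R) : (forall t i, t i = -oo%E -> g t = 0) ->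
  vol (fun=> -oo%E) (fun=> +oo%E) g = g (fun=> +oo%E).
Proof.
move=> g0; rewrite /vol (bigD1 finset.set0) //= cards0 /=.
rewrite (_ : mix _ _ _ = fun=> +oo%E); last by apply: funext => i; rewrite /mix inE.
rewrite big1 ?addr0 // => S /set0Pn[i iS].
by rewrite (g0 _ i) ?signed0 // /mix iS.
Qed.

Variable i0 : 'I_n.
Local Notation mu := (@lebesgue_measure R).

Let mu_sub0 (B C : set (measurableTypeR R)) : measurable B -> measurable C -> B `<=` C ->
  mu C = 0 -> mu B = 0.
Proof. exact: subset_measure0. Qed.

(** Enumerates all rational hyperplanes; the default value for numbers that code nothing merely
    repeats one of them. *)
Let gen (k : nat) : 'I_n * \bar rat :=
  let p := odflt (i0, 0) (unpickle k : option ('I_n * rat)) in (p.1, p.2%:E).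

Let genE (i : 'I_n) (c : rat) : gen (pickle (i, c)) = (i, c%:E).
Proof. by rewrite /gen pickleK. Qed.

Let J : set R := cell ext_phi (fun=> -oo%E) (fun=> +oo%E) gen [::].
Let D (i : 'I_n) (c : rat) : set R := side ext_phi (fun=> -oo%E) (fun=> +oo%E) gen (pickle (i, c)).
Let E (c : 'I_n -> rat) : set R := [set x | forall i, D i (c i) x].

Let noo_poo (i : 'I_n) : ((-oo : \bar rat) <= +oo)%O.
Proof. by []. Qed.

Let mJ : measurable J.
Proof. exact: measurable_cell. Qed.

Let mD i c : measurable (D i c).
Proof. exact: measurable_side. Qed.

Let mE c : measurable (E c).
Proof.
have -> : E c = \bigcap_i D i (c i) by apply/seteqP; split=> x h i //=; apply: h.
by apply: fin_bigcap_measurable => // i _; apply: mD.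
Qed.

#[local] Hint Extern 0 (measurable _) => exact: mJ : core.
#[local] Hint Extern 0 (measurable _) => exact: mD : core.
#[local] Hint Extern 0 (measurable _) => exact: mE : core.

Let muJ : mu J = 1%:E.
Proof.
rewrite mu_cell; [|exact: ext_phi_vol|exact: noo_poo].
by rewrite /mass /= vol_ext ?ext_phi_top //; exact: ext_phi_bot.
Qed.

Let muE c : mu (J `&` E c) = (phi c)%:E.
Proof.
rewrite (mu_sides ext_phi_vol noo_poo (c := fun i => (c i)%:E)) => [|i]; last exact: genE.
rewrite vol_ext => [|t i ti]; last by apply: (@ext_phi_bot _ i); rewrite ti min_l // leNye.
by congr EFin; rewrite -ext_phi_fin.
Qed.

Let D_mono i c c' : c <= c' -> D i c `<=` D i c'.
Proof.
rewrite -lee_fin => cc'.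
exact: (side_mono ext_phi_vol noo_poo (genE i c) (genE i c') cc').
Qed.

Let E_mono c c' : (forall i, c i <= c' i) -> E c `<=` E c'.
Proof. by move=> cc' x xE i; apply: (D_mono (cc' i)). Qed.

Let mu_union (c : nat -> 'I_n -> rat) : (forall k i, c k i <= c k.+1 i) ->
  (phi (c k))%:E @[k --> \oo] --> mu (J `&` \bigcup_k E (c k)).
Proof.
move=> cc; rewrite setI_bigcupr.
rewrite (_ : (fun k => _) = mu \o (fun k => J `&` E (c k))); last first.
  by apply: funext => k /=; rewrite muE.
apply: nondecreasing_cvg_mu.
- by move=> k; apply: measurableI.
- by apply: bigcupT_measurable => k; apply: measurableI.
- move=> k l kl; rewrite subsetEset; apply: setIS; apply: E_mono => i.
  elim: l kl => [|l IHl]; first by rewrite leqn0 => /eqP ->.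
  by rewrite leq_eqVlt => /orP[/eqP -> //|kl]; apply: le_trans (IHl kl) (cc l i).
Qed.

(** On [A] all coordinates are less than [+oo]; [N i] collects the points whose coordinate [i] would
    be [-oo]. *)
Let A : set R := J `&` \bigcup_k E (fun=> k%:R).
Let N i : set R := \bigcap_k D i (- k%:R).

Let mA : measurable A.
Proof. by apply: measurableI => //; apply: bigcupT_measurable. Qed.

Let mN i : measurable (N i).
Proof. by apply: bigcapT_measurable. Qed.

Let muA : mu A = 1%:E.
Proof.
have cv : (phi (fun=> k%:R))%:E @[k --> \oo] --> mu A.
  by apply: (@mu_union (fun k _ => k%:R)) => k i; rewrite ler_nat.
rewrite -(cvg_lim _ cv) //; apply: cvg_lim => //.
by apply: cvg_EFin phi_top; near=> k.
Unshelve. all: by end_near. Qed.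

(** The bound from [phi_bot] refers to growing cubes, so it applies to a fixed cube [M] once
    [M <= k]; the cubes then exhaust [A]. *)
Let muAN i : mu (A `&` N i) = 0.
Proof.
pose B M := J `&` E (fun=> M%:R) `&` N i.
have mB M : measurable (B M) by apply: measurableI => //; apply: measurableI.
have B0 M : mu (B M) = 0.
  have BK k : (M <= k)%N -> (mu (B M) <= (phi (upd (fun=> k%:R) i (- k%:R)))%:E)%E.
    move=> Mk; rewrite -muE; apply: le_measure.
    - by rewrite inE; exact: mB.
    - by rewrite inE; apply: measurableI; [exact: mJ|exact: mE].
    move=> x [[xJ xE] xN]; split=> // j; rewrite /upd; case: eqP => [->|_]; first exact: xN.
    by apply: D_mono (xE j); rewrite ler_nat.
  have finB : mu (B M) \is a fin_num.
    rewrite ge0_fin_numE //; apply: le_lt_trans (BK M _) _ => //.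
    exact: ltry.
  apply/eqP; rewrite eq_le measure_ge0 andbT -(fineK finB) lee_fin.
  rewrite -(cvg_lim _ (phi_bot i)) //; apply: limr_ge.
    by apply/cvg_ex; exists 0; apply: phi_bot.
  near=> k; rewrite -lee_fin fineK //; apply: BK.
  by near: k; apply: nbhs_infty_ge.
have : mu.-negligible (\bigcup_M B M).
  by apply: negligible_bigcup => M; apply/negligibleP; [exact: mB|exact: B0].
move=> /measure_negligible; rewrite (_ : A `&` N i = \bigcup_M B M).
  by apply; apply: bigcupT_measurable.
by rewrite /A setI_bigcupr setI_bigcupl.
Unshelve. all: by end_near. Qed.

Theorem random_vector : exists (Om : set R) (X : R -> 'I_n -> R),
  [/\ measurable Om, mu Om = 1%:E &
   forall (t : 'I_n -> R) (c : nat -> 'I_n -> rat),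
    (forall k i, c k i <= c k.+1 i) -> (forall k i, ratr (c k i) < t i) ->
    (forall i q, ratr q < t i -> exists k, q <= c k i) ->
    measurable (Om `&` [set x | forall i, X x i < t i]) /\
    (phi (c k))%:E @[k --> \oo] --> mu (Om `&` [set x | forall i, X x i < t i])].
Proof.
(* Outside [Om] the infimum defining the vector would be taken over an empty set or one that is
   unbounded below. *)
pose Om := A `\` \bigcup_i N i.
have mNU : measurable (\bigcup_i N i).
  by apply: fin_bigcup_measurable => // i _.
have mOm : measurable Om by apply: measurableD.
have muOm : mu Om = 1%:E.
  have AN0 : mu (A `&` \bigcup_i N i) = 0.
    apply: measure_negligible; first exact: measurableI.
    pose F k := if insub k is Some i then A `&` N i else set0.
    have : mu.-negligible (\bigcup_k F k).
      apply: negligible_bigcup => k; rewrite /F; case: insubP => [i _ _|_].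
        by apply/negligibleP; [apply: measurableI; [exact: mA|exact: mN]|exact: muAN].
      exact: negligible_set0.
    apply: negligibleS => x [xA [i _ xN]]; exists i => //; rewrite /F.
    by rewrite valK.
  by have := lebesgue_measureDI mA mNU; rewrite muA AN0 adde0.
have JOm : mu (J `\` Om) = 0.
  have JO : J `&` Om = Om by apply: setIidr => x [[]].
  have := lebesgue_measureDI mJ mOm; rewrite JO muJ muOm.
  case: (mu _) => [r||] //; rewrite -EFinD => -[r1]; congr EFin.
  by apply: (addIr 1); rewrite -r1 add0r.
have OmE B : measurable B -> mu (Om `&` B) = mu (J `&` B).
  move=> mB; have mJB : measurable (J `&` B) by apply: measurableI.
  rewrite (lebesgue_measureDI mJB mOm) (_ : mu (_ `\` _) = 0); last first.
    apply: (@mu_sub0 _ (J `\` Om)) JOm; [exact: measurableD|exact: measurableD|].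
    by move=> x [[]].
  rewrite add0e; congr (mu _); apply/seteqP; split=> x.
    by move=> [xO xB]; split=> //; split=> //; case: xO => -[].
  by move=> [[_ xB] xO].
exists Om, (fun x i => inf [set ratr c | c in [set c | D i c x]]); split=> // t c cc ct tc.
(* Being strictly below [t i] produces a rational below [t i] to the left of which the point lies,
   hence an index of the sequence [c]; the largest of these indices serves all coordinates. *)
have XE : Om `&` [set x | forall i, inf [set ratr c | c in [set c | D i c x]] < t i] =
    Om `&` \bigcup_k E (c k).
  apply/seteqP; split=> x [xO xX]; split=> //.
    have /choice[k ck] : forall i, exists k, D i (c k i) x.
      move=> i.
      have [|_ [q Dq <-] qt] := inf_lt _ (xX i).
        have [[_ [m _ xm]] _] := xO.
        by exists (ratr m%:R), m%:R => //; apply: xm.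
      by have [k qk] := tc i q qt; exists k; apply: D_mono qk _ Dq.
    exists (\max_i k i)%N => // i; apply: D_mono (ck i).
    have : (k i <= \max_j k j)%N by apply: (leq_bigmax i).
    elim: (\max_j k j)%N => [|m IHm].
      by rewrite leqn0 => /eqP ->.
    by rewrite leq_eqVlt => /orP[/eqP -> //|km]; apply: le_trans (IHm km) (cc m i).
  move=> i; have [k _ xk] := xX; apply: le_lt_trans (ct k i).
  apply: ge_inf; last by exists (c k i) => //; apply: xk.
  have [_ xN] := xO.
  have [m xm] : exists m : nat, ~ D i (- m%:R) x.
    apply: contrapT => nom; apply: xN; exists i => // m _.
    by apply: contrapT => h; apply: nom; exists m.
  exists (ratr (- m%:R)) => _ [q Dq <-]; rewrite ler_rat leNgt; apply/negP => /ltW qm.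
  by apply: xm; apply: D_mono qm _ Dq.
rewrite XE OmE; last exact: bigcupT_measurable.
split; last exact: mu_union.
by apply: measurableI => //; apply: bigcupT_measurable.
Qed.

End ExtendedDistribution.

(** * Measures with values in an interpolation group *)

Lemma decr_to0_sum (G : porderZmodType) (I : Type) (r : seq I) (x : I -> nat -> G) :
  po_group G -> (forall i, decr_to0 (x i)) -> decr_to0 (fun k => \sum_(i <- r) x i k).
Proof.
move=> hG x0; elim: r => [|i r IHr].
  rewrite (_ : (fun _ => _) = fun=> 0); last by apply: funext => k; rewrite big_nil.
  by split=> //; split=> // y /(_ 0%N).
rewrite (_ : (fun _ => _) = fun k => x i k + \sum_(i <- r) x i k).
  exact: decr_to0D.
by apply: funext => k; rewrite big_cons.
Qed.

(** * Monotonicity from non-negative volumes *)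

Section Increments.
Variables (R : realType) (n : nat) (G : porderZmodType) (hG : po_group G).
Variables (f : ('I_n -> R) -> G) (low : R).
Hypothesis f_vol : forall l r : 'I_n -> R, (forall i, l i <= r i) -> 0 <= vol l r f.
Hypothesis low_ge0 : forall x i, x i <= low -> 0 <= f x.
Hypothesis low_mono : forall (x y : 'I_n -> R) i,
  (forall j, x j <= y j) -> y i <= low -> f x <= f y.
Hypothesis low_lim : forall t i c, c <= low -> decr_to0 (fun k => f (upd t i (c - k%:R))).

(** In a box whose lower corner is [a] in direction [i] and far down elsewhere, every corner except
    [y] and [upd y i a] has a coordinate [c j - k] with [j != i]. There [f] is non-negative and at
    most one term of [E k], which decreases to 0. *)
Lemma increment_approx (y c : 'I_n -> R) i a : a <= y i ->
  (forall j, c j <= low) -> (forall j, c j <= y j) ->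
  exists2 e : nat -> G, decr_to0 e & forall k,
    let V := vol (upd (fun j => c j - k%:R) i a) y f in
    V <= f y - f (upd y i a) + e k /\ f y - f (upd y i a) <= V + e k.
Proof.
move=> ay cl cy.
pose E k := \sum_j f (upd y j (c j - k%:R)).
exists (fun k => \sum_(S : {set 'I_n}) E k) => [|k V].
  apply: decr_to0_sum => // S; apply: decr_to0_sum => // j; exact: low_lim.
have E_ge0 j : 0 <= f (upd y j (c j - k%:R)).
  by apply: (low_ge0 (i := j)); rewrite upd_same lerBlDr (le_trans (cl j)) // lerDl.
have E_le j : f (upd y j (c j - k%:R)) <= E k.
  rewrite /E (bigD1 j) //=.
  have h : 0 <= \sum_(j' | j' != j) f (upd y j' (c j' - k%:R)).
    exact: po_sum_ge0.
  by apply: (po_le_by hG h); zmod.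
set l := upd _ i a in V *.
have l_le j : l j <= y j.
  rewrite /l /upd; case: eqP => [->//|_].
  by rewrite lerBlDr (le_trans (cy j)) // lerDl.
have termE (S : {set 'I_n}) : i \notin S -> S != finset.set0 ->
    let x := signed (odd #|S|) (f (mix S l y) - f (upd (mix S l y) i (l i))) in
    x <= E k /\ - x <= E k.
  move=> iS /set0Pn[j jS] /=.
  have ji : j != i by apply: contraNneq iS => <-.
  have tb z : (forall j', z j' <= y j') -> z j = l j -> 0 <= f z /\ f z <= E k.
    move=> zy zj.
    have zlow : z j <= c j - k%:R by rewrite zj /l /upd (negPf ji).
    have cjl : c j - k%:R <= low by rewrite lerBlDr (le_trans (cl j)) // lerDl.
    split; first by apply: (low_ge0 (i := j)); apply: le_trans zlow cjl.
    apply: le_trans (E_le j); apply: (low_mono (i := j)); last by rewrite upd_same.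
    by move=> j'; rewrite /upd; case: eqP => [->|_].
  have [||p1 p2] := tb (mix S l y).
  - by move=> j'; rewrite /mix; case: ifP.
  - by rewrite /mix jS.
  have [||q1 q2] := tb (upd (mix S l y) i (l i)).
  - by move=> j'; rewrite /upd; case: eqP => [->//|_]; rewrite /mix; case: ifP.
  - by rewrite /upd (negPf ji) /mix jS.
  have h1 : f (mix S l y) - f (upd (mix S l y) i (l i)) <= E k.
    by apply: (po_le_by hG (po_leD hG p2 q1)); zmod.
  have h2 : - (f (mix S l y) - f (upd (mix S l y) i (l i))) <= E k.
    by apply: (po_le_by hG (po_leD hG q2 p1)); zmod.
  by case: (odd _) => /=; rewrite ?opprK.
have E0 : 0 <= E k by apply: le_trans (E_ge0 i) (E_le i).
rewrite {}/V (vol_pair i) (bigD1 finset.set0) ?inE //= cards0 /=.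
have -> : mix finset.set0 l y = y by apply: funext => j; rewrite /mix inE.
have -> : l i = a by rewrite /l upd_same.
set Z := \sum_(S | _) _.
have ZE : Z <= \sum_(S : {set 'I_n}) E k /\ - Z <= \sum_(S : {set 'I_n}) E k.
  have half (x : {set 'I_n} -> G) :
      (forall S : {set 'I_n}, i \notin S -> S != finset.set0 -> x S <= E k) ->
      \sum_(S : {set 'I_n} | (i \notin S) && (S != finset.set0)) x S <= \sum_(S : {set 'I_n}) E k.
    move=> xE; rewrite big_mkcond; apply: po_sum_le => // S _.
    by case: ifP => // /andP[iS S0]; apply: xE.
  split; first by apply: half => S iS S0; case: (termE S iS S0); rewrite /l upd_same.
  rewrite -sumrN; apply: half => S iS S0.
  by case: (termE S iS S0); rewrite /l upd_same.
case: ZE => Z1 Z2; split.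
  by apply: (po_le_by hG Z1); zmod.
by apply: (po_le_by hG Z2); zmod.
Qed.

Lemma increment_ge0 y i a : a <= y i -> f (upd y i a) <= f y.
Proof.
move=> ay; pose c j := Num.min low (y j).
have [|j|e e0 /= eV] := @increment_approx y c i a ay; first by move=> j; rewrite ge_min lexx.
  by rewrite ge_min lexx orbT.
rewrite -po_sub_ge0 //; suff h : - (f y - f (upd y i a)) <= 0.
  by apply: (po_le_by hG h); zmod.
have [_ [_ el]] := e0; apply: el => k; have [h _] := eV k.
have V0 : 0 <= vol (upd (fun j => c j - k%:R) i a) y f.
  apply: f_vol => j; rewrite /upd; case: eqP => [->//|_].
  by rewrite lerBlDr ge_min orbC lerDl ler0n.
by apply: (po_le_by hG (le_trans V0 h)); zmod.
Qed.

Lemma increments_mono s t : (forall i, s i <= t i) -> f s <= f t.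
Proof.
move=> st; pose w (r : seq 'I_n) j := if j \in r then s j else t j.
rewrite (_ : s = w (enum 'I_n)); last by apply: funext => j; rewrite /w mem_enum.
elim: (enum _) => [|i r IHr]; first by rewrite (_ : w [::] = t).
apply: le_trans IHr.
rewrite (_ : w (i :: r) = upd (w r) i (s i)); last first.
  by apply: funext => j; rewrite /w /upd inE; case: eqP => // ->.
by apply: increment_ge0; rewrite /w; case: ifP.
Qed.

(** Both increments are approximated by boxes with the same lower corner, and the box below [s] is
    contained in the box below [t]. *)
Lemma increments_incr s t i a : (forall j, s j <= t j) -> s i = t i -> a <= s i ->
  f s - f (upd s i a) <= f t - f (upd t i a).
Proof.
move=> st sti as_; pose c j := Num.min low (s j).
have cl j : c j <= low by rewrite ge_min lexx.
have cs j : c j <= s j by rewrite ge_min lexx orbT.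
have [e e0 /= eV] := increment_approx as_ cl cs.
have [||e' e'0 /= eV'] := @increment_approx t c i a _ cl; first by rewrite -sti.
  by move=> j; apply: le_trans (cs j) (st j).
suff h : f s - f (upd s i a) - (f t - f (upd t i a)) <= 0 by apply: (po_le_by hG h); zmod.
have [_ [_ el]] := decr_to0D hG e0 e'0; apply: el => k.
have [_ h] := eV k; have [h' _] := eV' k.
have hv : vol (upd (fun j => c j - k%:R) i a) s f <= vol (upd (fun j => c j - k%:R) i a) t f.
  apply: vol_sub => // j; rewrite /upd; case: eqP => [->//|_].
  by rewrite lerBlDr (le_trans (cs j)) // lerDl.
by apply: (po_le_by hG (po_leD hG hv (po_leD hG h h'))); zmod.
Qed.

End Increments.

Section StateLemmas.
Variables (R : realType) (G : porderZmodType) (hG : po_group G) (v : G) (s : G -> R).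
Hypothesis (hs : state v s).

Lemma state_signed b g : linear_at s g -> s (signed b g) = signed b (s g).
Proof. by case: b. Qed.

Lemma state_sum_signed (I : Type) (r : seq I) (e : I -> bool) (x : I -> G) :
  (forall i, bounded_by v (x i)) -> (forall i, linear_at s (x i)) ->
  [/\ bounded_by v (\sum_(i <- r) signed (e i) (x i)),
    linear_at s (\sum_(i <- r) signed (e i) (x i)) &
    s (\sum_(i <- r) signed (e i) (x i)) = \sum_(i <- r) signed (e i) (s (x i))].
Proof.
move=> bx lx.
have bs i : bounded_by v (signed (e i) (x i)).
  by case: (e i) => //=; apply: bounded_byN.
have ls i : linear_at s (signed (e i) (x i)).
  by case: (e i) => //=; apply: linear_atN.
elim: r => [|i r [IH1 IH2 IH3]].
  rewrite !big_nil; split; first by exists 0%N; rewrite mulr0n oppr0.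
    exact: linear_at0 hs.
  exact: state_0 hs.
rewrite !big_cons; split.
- exact: bounded_byD.
- by apply: (linear_atD hG hs).
- by rewrite (state_add hG hs) // IH3 state_signed.
Qed.

Lemma preserves_cvg (c : nat -> G) : decr_to0 c -> (forall k, bounded_by v (c k)) ->
  preserves s c -> s (c k) @[k --> \oo] --> (0 : R).
Proof.
move=> dc bc pc; apply/cvgr0Pnorm_le => e e0.
have [m me] : exists m : nat, m.+1%:R^-1 <= e.
  exists (Num.bound e^-1); rewrite invf_ple ?posrE ?ltr0n //.
  apply: le_trans (ltW (archi_boundP _)) _; first by rewrite invr_ge0 ltW.
  by rewrite ler_nat.
have [k0 hk0] := pc m.
near=> k; rewrite ger0_norm; last by apply: (state_ge0 hs) => //; apply: decr_to0_ge0.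
apply: le_trans (le_trans hk0 me); apply: (state_le hs) => //.
by apply: decr_le dc.1 _; near: k; apply: nbhs_infty_ge.
Unshelve. all: by end_near. Qed.

End StateLemmas.

Lemma generic_state_count (R : realType) (G : porderZmodType) (I J : countType)
    (v b : G) (e : I -> G) (c : J -> nat -> G) :
  po_group G -> directed_group G -> monotone_sigma_complete G -> interpolation G ->
  0 <= v -> bounded_by v b -> ~ 0 <= b ->
  (forall i, bounded_by v (e i)) -> (forall j k, bounded_by v (c j k)) ->
  (forall j, decr_to0 (c j)) ->
  exists s : G -> R, [/\ state v s, s b < 0, forall i, linear_at s (e i) &
    forall j, preserves s (c j)].
Proof.
move=> hG dG sG iG v0 bb b0 be bc dc.
have b00 : bounded_by v 0 by exists 0%N; rewrite mulr0n oppr0.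
pose e' k := if unpickle k is Some i then e i else 0.
pose c' k := if unpickle k is Some j then c j else fun=> 0.
have [|k l|k|s [hs sb le pc]] := @generic_state G hG dG sG iG R v b e' c' v0 bb b0.
- by move=> k; rewrite /e'; case: unpickle.
- by rewrite /c'; case: unpickle.
- rewrite /c'; case: unpickle => [j|]; first exact: dc.
  by split=> //; split=> // y /(_ 0%N).
exists s; split=> // [i|j].
  by have := le (pickle i); rewrite /e' pickleK.
by have := pc (pickle j); rewrite /c' pickleK.
Qed.

Lemma rat_approx (R : realType) (n : nat) (t : 'I_n -> R) :
  exists c : nat -> 'I_n -> rat, [/\ forall k i, c k i <= c k.+1 i,
    forall k i, ratr (c k i) < t i &
    forall s : 'I_n -> R, (forall i, s i < t i) -> exists k, forall i, s i <= ratr (c k i)].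
Proof.
have inst (x y : 'I_n -> R) : (forall i, x i < y i) ->
    exists c : 'I_n -> rat, forall i, x i < ratr (c i) < y i.
  move=> xy; have /choice[c cP] : forall i, exists q : rat, x i < ratr q < y i.
    by move=> i; have [q] := rat_in_itvoo (xy i); rewrite in_itv; exists q.
  by exists c.
have [|c0 c0P] := @inst (fun i => t i - 1) t; first by move=> i; rewrite gtrBl.
have [i|k c ct|c [_ ct cc]] := @invariant_choice _ (fun c => forall i, ratr (c i) < t i)
    (fun k c c' => forall i, (c i <= c' i) && (t i - k.+1%:R^-1 < ratr (c' i))) c0.
- by case/andP: (c0P i).
- have [i|c' c'P] := @inst (fun i => Num.max (ratr (c i)) (t i - k.+1%:R^-1)) t.
    by rewrite gt_max ct gtrBl invr_gt0 ltr0n.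
  exists c' => i; have := c'P i; rewrite gt_max => /andP[/andP[h1 h2] h3] //.
  by rewrite h2 -(ler_rat R) ltW.
exists c; split=> // [k i|s st]; first by case/andP: (cc k i).
have /choice[m mP] : forall i, exists m : nat, s i <= t i - m.+1%:R^-1.
  move=> i; exists (Num.bound (t i - s i)^-1).
  have ts : 0 < t i - s i by rewrite subr_gt0.
  rewrite lerBrDr -lerBrDl invf_ple ?posrE ?ltr0n //.
  apply: le_trans (ltW (archi_boundP _)) _; first by rewrite invr_ge0 ltW.
  by rewrite ler_nat.
exists (\max_i m i).+1 => i; apply: le_trans (mP i) _.
have /andP[_ /ltW h] := cc (\max_i m i)%N i; apply: le_trans h.
rewrite lerD2l lerN2 lef_pV2 ?posrE ?ltr0n // ler_nat ltnS.
exact: (leq_bigmax i).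
Qed.

Definition orthant (R : realType) (n : nat) (t : 'rV[R]_n) : set 'rV[R]_n :=
  [set x | rV_ll x t].

(** An open set is a countable union of half-open rational boxes, and such a box is an orthant minus
    [n] smaller orthants. *)
Lemma borel_sub_orthant (R : realType) (n : nat) (A : set 'rV[R]_n) :
  borel_rV A -> <<s range (@orthant R n) >> A.
Proof.
apply: smallest_sub; first exact: smallest_sigma_algebra.
move=> U oU.
pose T := g_sigma_algebraType (range (@orthant R n)).
have mO t : measurable (orthant t : set T) by apply: sub_sigma_algebra; exists t.
pose box (p : {ffun 'I_n -> rat} * {ffun 'I_n -> rat}) : set T :=
  [set x : 'rV[R]_n | forall i, ratr (p.1 i) <= x 0 i < ratr (p.2 i)].
have mbox p : measurable (box p).
  pose b : 'rV[R]_n := \row_i ratr (p.2 i).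
  have -> : box p = (orthant b : set T) `\` \bigcup_i (orthant (rV_upd b i (ratr (p.1 i))) : set T).
    apply/seteqP; split=> x /=.
      move=> xb; split=> [i|[i _ /(_ i)]]; first by rewrite mxE; case/andP: (xb i).
      by rewrite mxE eqxx ltNge; case/andP: (xb i) => ->.
    move=> [xb xN] i; have := xb i; rewrite mxE => ->; rewrite andbT leNgt.
    apply/negP => xi; apply: xN; exists i => // j; rewrite mxE.
    by case: eqP => [->//|_].
  apply: measurableD => //; apply: fin_bigcup_measurable => // i _; exact: mO.
suff -> : U = \bigcup_p (if `[< box p `<=` U >] then box p else set0).
  apply: (@countable_bigcupT_measurable _ T) => [|p]; first exact: countableP.
  by case: ifP => _; [exact: mbox|exact: measurable0].
apply/seteqP; split=> x; last by move=> [p _]; case: ifP => // /asboolP; apply.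
move=> Ux; have /nbhs_ballP[e /= e0 xe] : nbhs x U by apply: open_nbhs_nbhs.
have /choice[a aP] : forall i, exists q : rat, x 0 i - e < ratr q < x 0 i.
  move=> i; have [|q] := @rat_in_itvoo R (x 0 i - e) (x 0 i); first by rewrite gtrBl.
  by rewrite in_itv; exists q.
have /choice[b bP] : forall i, exists q : rat, x 0 i < ratr q < x 0 i + e.
  move=> i; have [|q] := @rat_in_itvoo R (x 0 i) (x 0 i + e); first by rewrite ltrDl.
  by rewrite in_itv; exists q.
exists (finfun a, finfun b) => //; rewrite asboolT.
  by move=> i; rewrite !ffunE; have /andP[_ /ltW ->] := aP i; have /andP[-> _] := bP i.
move=> y yb; apply: xe; split=> // i j; rewrite ord1.
have := yb j; rewrite /= !ffunE => /andP[y1 y2].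
have /andP[a1 _] := aP j; have /andP[_ b2] := bP j.
by rewrite /ball /= ltr_norml; apply/andP; split; lra.
Qed.

(** * The value of a Borel set in G *)

Section GroupMeasure.
Variables (R : realType) (n : nat) (G : porderZmodType).
Hypotheses (hG : po_group G) (dG : directed_group G).
Hypotheses (sG : monotone_sigma_complete G) (iG : interpolation G).
Variables (i0 : 'I_n) (f : ('I_n -> R) -> G) (v : G).
Hypothesis f_vol : forall l r : 'I_n -> R, (forall i, l i <= r i) -> 0 <= vol l r f.
Hypothesis f_mono : forall s t : 'I_n -> R, (forall i, s i <= t i) -> f s <= f t.
Hypothesis f_ge0 : forall t, 0 <= f t.
Hypothesis f_le : forall t, f t <= v.
Hypothesis f_incr : forall (s t : 'I_n -> R) i a, (forall j, s j <= t j) -> s i = t i ->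
  a <= s i -> f s - f (upd s i a) <= f t - f (upd t i a).
Hypothesis f_left : forall t y, (forall s, (forall i, s i < t i) -> f s <= y) -> f t <= y.
Hypothesis f_bot : forall t i, decr_to0 (fun k => f (upd t i (- k%:R))).
Hypothesis f_top : seq_lub (fun k => f (fun=> k%:R)) v.

Local Notation mu := (@lebesgue_measure R).
Local Notation rat_vec c := (fun i => ratr (c i) : R).

Let v0 : 0 <= v.
Proof. exact: le_trans (f_ge0 _) (f_le (fun=> 0)). Qed.

Let f_bounded t : bounded_by v (f t).
Proof. exact: bounded_by_ge0. Qed.

Definition base_elt (c : {ffun 'I_n -> rat}) : G := f (rat_vec c).

(** Continuity along these sequences prevents mass from escaping: to minus infinity in direction [i]
    below the corner [M], and out of the growing orthants. *)
Definition base_seq (j : nat * 'I_n + unit) (k : nat) : G :=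
  match j with
  | inl (M, i) => f (upd (fun=> M%:R) i (- k%:R))
  | inr _ => v - f (fun=> k%:R)
  end.

Record good_state (s : G -> R) : Prop := GoodState {
  gs_state :> state v s;
  gs_linear : forall c, linear_at s (base_elt c);
  gs_preserves : forall j, preserves s (base_seq j)
}.

(* [X] is a random vector on [(Om, mu)] with distribution function [s \o f]. *)
Definition models (s : G -> R) (Om : set R) (X : R -> 'I_n -> R) :=
  [/\ measurable Om, mu Om = 1%:E &
   forall (t : 'I_n -> R) (c : nat -> 'I_n -> rat),
    (forall k i, c k i <= c k.+1 i) -> (forall k i, ratr (c k i) < t i) ->
    (forall i q, ratr q < t i -> exists k, q <= c k i) ->
    measurable (Om `&` [set x | forall i, X x i < t i]) /\
    (s (f (rat_vec (c k))))%:E @[k --> \oo] -->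
      mu (Om `&` [set x | forall i, X x i < t i])].

Lemma base_seq_decr j : decr_to0 (base_seq j).
Proof.
case: j => [[M i]|[]]; first exact: f_bot.
apply: seq_lub_sub => // k; apply: f_mono => i.
by rewrite ler_nat.
Qed.

Lemma base_seq_bounded j k : bounded_by v (base_seq j k).
Proof.
case: j => [[M i]|[]]; first exact: f_bounded.
apply: bounded_byD => //; first exact: bounded_by_ge0.
exact: bounded_byN.
Qed.

Lemma good_state_linear s (c : 'I_n -> rat) : good_state s -> linear_at s (f (rat_vec c)).
Proof.
move=> hs; have := gs_linear hs (finfun c); rewrite /base_elt.
by congr (linear_at s (f _)); apply: funext => i; rewrite ffunE.
Qed.

Lemma good_state_models s : good_state s -> exists Om X, models s Om X.
Proof.
move=> hs; have linf c := good_state_linear c hs.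
have cv j : s (base_seq j k) @[k --> \oo] --> (0 : R).
  apply: (preserves_cvg hs); [exact: base_seq_decr|exact: base_seq_bounded|].
  exact: gs_preserves.
apply: (@random_vector R n (fun c => s (f (rat_vec c)))) i0.
- move=> l r lr.
  have [bS _ sS] := @state_sum_signed R G hG v s hs _ (index_enum {set 'I_n})
    (fun S => odd #|S|) (fun S => f (rat_vec (mix S l r))) (fun=> f_bounded _)
    (fun=> linf _).
  rewrite /vol -sS; apply: (state_ge0 hs) => //.
  rewrite (eq_bigr (fun S : {set 'I_n} => signed (odd #|S|)
    (f (mix S (rat_vec l) (rat_vec r))))); last first.
    by move=> S _; congr (signed _ (f _)); apply: funext => i; rewrite /mix; case: ifP.
  by apply: f_vol => i; rewrite ler_rat.
- move=> c c' cc'; apply: (state_le hs) => //; apply: f_mono => i.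
  by rewrite ler_rat.
- by move=> c; apply: (state_ge0 hs).
- move=> i; apply/cvgr0Pnorm_le => e e0.
  have e20 : 0 < e / 2 by rewrite divr_gt0.
  have /cvgr0Pnorm_le /(_ _ e20) [M _ sM] := cv (inr tt).
  have /cvgr0Pnorm_le /(_ _ e20) [M' _ sM'] := cv (inl (M, i)).
  near=> k.
  have Mk : (M <= k)%N by near: k; apply: nbhs_infty_ge.
  have Mk' : (M' <= k)%N by near: k; apply: nbhs_infty_ge.
  have -> : rat_vec (upd (fun=> k%:R) i (- k%:R)) = upd (fun=> k%:R) i (- k%:R).
    by apply: funext => j; rewrite /upd; case: eqP => _; rewrite ?ratr_nat // raddfN /= ratr_nat.
  rewrite ger0_norm; last by apply: (state_ge0 hs).
  have kk : - k%:R <= k%:R :> R by apply: le_trans (ler0n R k); rewrite oppr_le0.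
  (* By [f_incr], raising the other coordinates from [M] to [k] only enlarges the increment in
     direction [i]. So the mass near minus infinity is at most its part below the corner [M] plus
     all the mass not below [M]. *)
  have le1 : f (upd (fun=> k%:R) i (- k%:R)) <= base_seq (inl (M, i)) k + base_seq (inr tt) M.
    have sk j : upd (fun=> M%:R) i k%:R j <= k%:R :> R.
      by rewrite /upd; case: eqP => // _; rewrite ler_nat.
    have := @f_incr (upd (fun=> M%:R) i k%:R) (fun=> k%:R) i (- k%:R) sk.
    rewrite upd_same upd_upd => h; have {}h := h erefl kk; rewrite /=.
    have h1 : f (fun=> M%:R) <= f (upd (fun=> M%:R) i k%:R).
      by apply: f_mono => j; rewrite /upd; case: eqP => // _; rewrite ler_nat.
    by apply: (po_le_by hG (po_leD hG h (po_leD hG h1 (f_le (fun=> k%:R))))); zmod.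
  have b1 := base_seq_bounded (inl (M, i)) k.
  have b2 := base_seq_bounded (inr tt) M.
  have := state_le hs (f_bounded _) (bounded_byD hG b1 b2) le1.
  have := state_subadd hs b1 b2.
  have := ler_norm (s (base_seq (inl (M, i)) k)).
  have := ler_norm (s (base_seq (inr tt) M)).
  have := sM M (leqnn M); have := sM' k Mk'.
  by lra.
- have cv1 := cv (inr tt).
  rewrite (_ : (fun k => _) = fun k => 1 - s (base_seq (inr tt) k)).
    by rewrite -[X in _ --> X]subr0; apply: cvgB => //; apply: cvg_cst.
  apply: funext => k /=.
  have -> : (fun _ : 'I_n => ratr k%:R : R) = fun=> k%:R by apply: funext => j; rewrite ratr_nat.
  have lk : linear_at s (f (fun=> k%:R)).
    have := linf (fun=> k%:R); congr (linear_at s (f _)).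
    by apply: funext => j; rewrite ratr_nat.
  have bv : bounded_by v v by apply: bounded_by_ge0.
  rewrite [v - _]addrC (state_add hG hs (bounded_byN hG (f_bounded _)) bv (linear_atN lk)).
  by rewrite lk (state_unit hs) opprD opprK addrCA subrr addr0.
Unshelve. all: by end_near. Qed.

Definition pull (X : R -> 'I_n -> R) (A : set 'rV[R]_n) : set R :=
  [set w | A (\row_j X w j)].

(* [g] is the value of the measure at [A]: this is certified by countably many
   elements and sequences, such that any state linear on the former and
   continuous along the latter takes at [g] the probability of [A]. *)
Definition has_value (A : set 'rV[R]_n) (g : G) : Prop :=
  [/\ 0 <= g, g <= v &
   exists (e : nat -> G) (c : nat -> nat -> G),
   [/\ forall i, bounded_by v (e i), forall j k, bounded_by v (c j k),
    forall j, decr_to0 (c j) &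
    forall s Om X, good_state s -> models s Om X ->
      (forall i, linear_at s (e i)) -> (forall j, preserves s (c j)) ->
      [/\ linear_at s g, measurable (Om `&` pull X A) &
        mu (Om `&` pull X A) = (s g)%:E]]].

Lemma has_value_intro (I J : countType) (e : I -> G) (c : J -> nat -> G) A g :
  0 <= g -> g <= v -> (forall i, bounded_by v (e i)) ->
  (forall j k, bounded_by v (c j k)) -> (forall j, decr_to0 (c j)) ->
  (forall s Om X, good_state s -> models s Om X ->
      (forall i, linear_at s (e i)) -> (forall j, preserves s (c j)) ->
      [/\ linear_at s g, measurable (Om `&` pull X A) &
        mu (Om `&` pull X A) = (s g)%:E]) ->
  has_value A g.
Proof.
move=> g0 gv be bc dc H; split=> //.
exists (fun k => if unpickle k is Some i then e i else 0).
exists (fun k => if unpickle k is Some j then c j else fun=> 0).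
have b00 : bounded_by v 0 by exists 0%N; rewrite mulr0n oppr0.
split=> [i|j k|j|s Om X hs hX le pc].
- by case: unpickle.
- by case: unpickle.
- case: unpickle => [j'|]; first exact: dc.
  by split=> //; split=> // y /(_ 0%N).
apply: H => // [i|j].
  by have := le (pickle i); rewrite pickleK.
by have := pc (pickle j); rewrite pickleK.
Qed.

Lemma has_value_le A B g h : has_value A g -> has_value B h -> A `<=` B -> g <= h.
Proof.
move=> [g0 gv [e [c [be bc dc Ag]]]] [h0 hv [e' [c' [be' bc' dc' Bh]]]] AB.
apply: contrapT => gh.
have bg : bounded_by v g by apply: bounded_by_ge0.
have bh : bounded_by v h by apply: bounded_by_ge0.
(* Both certificates and the conditions for a good state are still countable, so one generic state
   meets them all. *)
pose ee (i : {ffun 'I_n -> rat} + (nat + nat)) := match i with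
  | inl q => base_elt q | inr (inl k) => e k | inr (inr k) => e' k end.
pose cc (j : (nat * 'I_n + unit) + (nat + nat)) := match j with
  | inl j => base_seq j | inr (inl k) => c k | inr (inr k) => c' k end.
have bee i : bounded_by v (ee i).
  by case: i => [q|[k|k]] /=; [exact: f_bounded|exact: be|exact: be'].
have bcc j l : bounded_by v (cc j l).
  by case: j => [j|[k|k]] /=; [exact: base_seq_bounded|exact: bc|exact: bc'].
have dcc j : decr_to0 (cc j).
  by case: j => [j|[k|k]] /=; [exact: base_seq_decr|exact: dc|exact: dc'].
have hg0 : ~ 0 <= h - g by move=> hg; apply: gh; rewrite -(po_sub_ge0 hG).
have [s [hs sb le pc]] := @generic_state_count R G _ _ v (h - g) ee cc hG dG sG iG v0
    (bounded_byD hG bh (bounded_byN hG bg)) hg0 bee bcc dcc.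
have gs : good_state s.
  by split=> // [q|j]; [exact: (le (inl q))|exact: (pc (inl j))].
have [Om [X hX]] := good_state_models gs.
have [lg mA muA] := Ag s Om X gs hX (fun k => le (inr (inl k))) (fun k => pc (inr (inl k))).
have [lh mB muB] := Bh s Om X gs hX (fun k => le (inr (inr k))) (fun k => pc (inr (inr k))).
move: sb; rewrite (state_sub hG hs) // subr_lt0 ltNge => /negP; apply.
rewrite -lee_fin -muA -muB; apply: le_measure; rewrite ?inE //.
by apply: setIS => w; apply: AB.
Qed.

Lemma has_value_uniq A g h : has_value A g -> has_value A h -> g = h.
Proof. by move=> Ag Ah; apply: le_anti; rewrite (has_value_le Ag Ah) // (has_value_le Ah Ag). Qed.

Lemma has_valueT : has_value setT v.
Proof.
apply: (@has_value_intro unit void (fun=> v) (fun j => match j with end)) => //.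
  by move=> _; apply: bounded_by_ge0.
move=> s Om X hs [mOm muOm _] lv _; rewrite (_ : pull X setT = setT) ?setIT.
  by split=> //; [exact: lv tt|rewrite (state_unit hs)].
by apply/seteqP; split.
Qed.

Lemma has_value_setC A g : has_value A g -> has_value (~` A) (v - g).
Proof.
move=> [g0 gv [e [c [be bc dc Ag]]]].
have bv : bounded_by v v by apply: bounded_by_ge0.
have bg : bounded_by v g by apply: bounded_by_ge0.
apply: (@has_value_intro (option nat) nat (fun i => if i is Some k then e k else v) c) => //.
- by rewrite po_sub_ge0.
- by apply: (po_le_by hG g0); zmod.
- by move=> i; case: i.
move=> s Om X gs hX le pc; have [mOm muOm _] := hX.
have [lg mA muA] := Ag s Om X gs hX (fun k => le (Some k)) pc.
have lv : linear_at s v := le None.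
have OmC : Om `&` pull X (~` A) = Om `\` (Om `&` pull X A).
  apply/seteqP; split=> w [wO wA]; split=> //; first by case.
  by move=> xA; apply: wA.
rewrite OmC; split.
- by apply: (linear_atD hG gs) => //; [exact: bounded_byN|exact: linear_atN].
- exact: measurableD.
- rewrite (state_sub hG gs) // (state_unit gs).
  have := lebesgue_measureDI mOm mA.
  have -> : Om `&` (Om `&` pull X A) = Om `&` pull X A by rewrite setIA setIid.
  rewrite muOm muA; case: (mu _) => [r||] //.
  by rewrite -EFinD => -[->]; rewrite addrK.
Qed.

Lemma has_value_setU A B g h : has_value A g -> has_value B h -> A `&` B = set0 ->
  has_value (A `|` B) (g + h).
Proof.
move=> hA hB AB; have [g0 gv [e [c [be bc dc Ag]]]] := hA.
have [h0 hv [e' [c' [be' bc' dc' Bh]]]] := hB.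
have bg : bounded_by v g by apply: bounded_by_ge0.
have bh : bounded_by v h by apply: bounded_by_ge0.
apply: (@has_value_intro (nat + nat)%type (nat + nat)%type
  (fun i => match i with inl k => e k | inr k => e' k end)
  (fun i => match i with inl k => c k | inr k => c' k end)).
- by rewrite -[0]addr0; apply: po_leD.
(* Disjointness puts [B] inside the complement of [A]; monotonicity of values then bounds [g + h] by
   [v]. *)
- have : h <= v - g.
    apply: (has_value_le hB (has_value_setC hA)) => x Bx Ax.
    by have : (A `&` B) x by []; rewrite AB.
  by move=> hvg; apply: (po_le_by hG hvg); zmod.
- by move=> i; case: i.
- by move=> i; case: i.
- by move=> i; case: i.
move=> s Om X gs hX le pc.
have [lg mA muA] := Ag s Om X gs hX (fun k => le (inl k)) (fun k => pc (inl k)).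
have [lh mB muB] := Bh s Om X gs hX (fun k => le (inr k)) (fun k => pc (inr k)).
have -> : Om `&` pull X (A `|` B) = (Om `&` pull X A) `|` (Om `&` pull X B).
  by rewrite -setIUr.
split.
- exact: (linear_atD hG gs).
- exact: measurableU.
- rewrite (state_add hG gs) // EFinD -muA -muB; apply: measureU => //.
  apply/seteqP; split=> // w [[_ wA] [_ wB]].
  by have : (A `&` B) (\row_j X w j) by []; rewrite AB.
Qed.

Lemma has_value_bigcup (A : nat -> set 'rV[R]_n) (g : nat -> G) :
  (forall k, has_value (A k) (g k)) -> (forall k, A k `<=` A k.+1) ->
  exists2 z, seq_lub g z & has_value (\bigcup_k A k) z.
Proof.
move=> hA AA.
have gg k : g k <= g k.+1 by apply: has_value_le (hA k) (hA k.+1) (AA k).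
have g0 k : 0 <= g k by case: (hA k).
have gv k : g k <= v by case: (hA k).
have [z zl] := seq_lub_exists sG gg gv.
exists z => //; have [gz zmin] := zl.
have z0 : 0 <= z by apply: le_trans (gz 0%N).
have zv : z <= v by apply: zmin.
have bz : bounded_by v z by apply: bounded_by_ge0.
have bg k : bounded_by v (g k) by apply: bounded_by_ge0.
have /choice[ec ecP] : forall k, exists ec : (nat -> G) * (nat -> nat -> G),
    [/\ forall i, bounded_by v (ec.1 i), forall j k, bounded_by v (ec.2 j k),
    forall j, decr_to0 (ec.2 j) &
    forall s Om X, good_state s -> models s Om X ->
      (forall i, linear_at s (ec.1 i)) -> (forall j, preserves s (ec.2 j)) ->
      [/\ linear_at s (g k), measurable (Om `&` pull X (A k)) &
        mu (Om `&` pull X (A k)) = (s (g k))%:E]].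
  by move=> k; have [_ _ [e [c ?]]] := hA k; exists (e, c).
have dz := seq_lub_sub hG gg zl.
have bzg k : bounded_by v (z - g k) by apply: bounded_byD => //; apply: bounded_byN.
(* Besides the certificates of all [A k], [None] requests linearity at [z] and continuity along
   [z - g k], so that [s (g k)] tends to [s z]. *)
apply: (@has_value_intro (option (nat * nat)) (option (nat * nat))
  (fun i => if i is Some (k, i) then (ec k).1 i else z)
  (fun j => if j is Some (k, j) then (ec k).2 j else fun k => z - g k)) => //.
- by move=> p; case: p => [[k i]|] //; case: (ecP k).
- by move=> p l; case: p => [[k i]|] //; case: (ecP k).
- by move=> p; case: p => [[k i]|] //; case: (ecP k).
move=> s Om X gs hX le pc.
have val k : [/\ linear_at s (g k), measurable (Om `&` pull X (A k)) &
        mu (Om `&` pull X (A k)) = (s (g k))%:E].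
  have [_ _ _] := ecP k; apply=> // [i|j]; first exact: (le (Some (k, i))).
  exact: (pc (Some (k, j))).
have lz : linear_at s z := le None.
have UE : Om `&` pull X (\bigcup_k A k) = \bigcup_k (Om `&` pull X (A k)).
  apply/seteqP; split=> w; first by move=> [wO [k _ wk]]; exists k.
  by move=> [k _ [wO wk]]; split=> //; exists k.
have mU : measurable (\bigcup_k (Om `&` pull X (A k))).
  by apply: bigcupT_measurable => k; case: (val k).
rewrite UE; split=> //.
have cv1 : mu (Om `&` pull X (A k)) @[k --> \oo] --> mu (\bigcup_k (Om `&` pull X (A k))).
  apply: nondecreasing_cvg_mu => //; first by move=> k; case: (val k).
  move=> k l kl; rewrite subsetEset; apply: setIS => w.
  elim: l kl => [|l IHl]; first by rewrite leqn0 => /eqP ->.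
  by rewrite leq_eqVlt => /orP[/eqP -> //|kl] wk; apply: AA; apply: IHl kl wk.
have cvs : s (g k) @[k --> \oo] --> s z.
  have cv := preserves_cvg gs dz bzg (pc None).
  rewrite (_ : (fun k => s (g k)) = fun k => s z - s (z - g k)).
    by rewrite -[X in _ --> X]subr0; apply: cvgB => //; apply: cvg_cst.
  apply: funext => k; have [lk _ _] := val k.
  by rewrite (state_sub hG gs) // opprB addrCA subrr addr0.
have cv2 : (s (g k))%:E @[k --> \oo] --> (s z)%:E by apply: cvg_EFin cvs; near=> k.
rewrite -(cvg_lim _ cv1) //; apply: cvg_lim => //.
by rewrite (_ : (fun k => mu _) = fun k => (s (g k))%:E) //; apply: funext => k; case: (val k).
Unshelve. all: by end_near. Qed.

(** Left continuity makes [f (t 0)] the supremum of values at rational points; the certificate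
    requests linearity there and continuity along the differences. *)
Lemma has_value_orthant t : has_value (orthant t) (f (t 0)).
Proof.
have [c [cc ct cofinal]] := rat_approx (t 0).
have fcc k : f (rat_vec (c k)) <= f (rat_vec (c k.+1)).
  by apply: f_mono => i; rewrite ler_rat.
have flub : seq_lub (fun k => f (rat_vec (c k))) (f (t 0)).
  split=> [k|y fy]; first by apply: f_mono => i; apply: ltW.
  apply: f_left => s st; have [k sk] := cofinal s st.
  by apply: le_trans (fy k); apply: f_mono.
have dc := seq_lub_sub hG fcc flub.
have bd k : bounded_by v (f (t 0) - f (rat_vec (c k))).
  by apply: bounded_byD => //; apply: bounded_byN.
apply: (@has_value_intro unit unit (fun=> f (t 0))
  (fun _ k => f (t 0) - f (rat_vec (c k)))) => // s Om X gs hX lt pt.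
have [mOm _ hXt] := hX.
have [|mU cvU] := hXt (t 0) c cc ct.
  move=> i q qt.
  have [|k qk] := cofinal (upd (rat_vec (c 0%N)) i (ratr q)).
    by move=> j; rewrite /upd; case: eqP => [->|_].
  by exists k; have := qk i; rewrite upd_same ler_rat.
have -> : pull X (orthant t) = [set x | forall i, X x i < t 0 i].
  by apply/seteqP; split=> w h i; have := h i; rewrite mxE.
have lft : linear_at s (f (t 0)) := lt tt.
split=> //.
have cvs : s (f (rat_vec (c k))) @[k --> \oo] --> s (f (t 0)).
  have cv := preserves_cvg gs dc bd (pt tt).
  rewrite (_ : (fun k => s (f _)) = fun k => s (f (t 0)) - s (f (t 0) - f (rat_vec (c k)))).
    by rewrite -[X in _ --> X]subr0; apply: cvgB => //; apply: cvg_cst.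
  apply: funext => k; rewrite (state_sub hG gs) //; last exact: good_state_linear.
  by rewrite opprB addrCA subrr addr0.
have cv2 : (s (f (rat_vec (c k))))%:E @[k --> \oo] --> (s (f (t 0)))%:E.
  by apply: cvg_EFin cvs; near=> k.
by rewrite -(cvg_lim _ cvU) //; apply: cvg_lim.
Unshelve. all: by end_near. Qed.

(** The sets with a value form a Dynkin system, disjoint unions being increasing unions of partial
    ones, and orthants are closed under intersection. *)
Lemma has_value_exists A : borel_rV A -> exists g, has_value A g.
Proof.
move=> /borel_sub_orthant.
rewrite -setI_closed_g_dynkin_g_sigma_algebra; last first.
  move=> _ _ [s _ <-] [t _ <-]; exists (rV_meet s t) => //.
  apply/seteqP; split=> x.
    by move=> h; split=> i; have := h i; rewrite mxE lt_min => /andP[].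
  by move=> [xs xt] i; rewrite mxE lt_min xs xt.
move=> dA; pose D : set (set 'rV[R]_n) := [set A | exists g, has_value A g].
apply: (dA D); split; last by move=> _ [t _ <-]; exists (f (t 0)); apply: has_value_orthant.
split; first by exists v; apply: has_valueT.
  by move=> B [g Bg]; exists (v - g); apply: has_value_setC.
move=> B tB DB.
pose C k := \big[setU/set0]_(j < k) B j.
have hC k : exists g, has_value (C k) g.
  elim: k => [|k [g Cg]].
    exists (v - v); rewrite /C big_ord0 -setCT; apply: has_value_setC.
    exact: has_valueT.
  have [h Bh] := DB k; exists (g + h); rewrite /C big_ord_recr.
  apply: has_value_setU => //; apply/seteqP; split=> // x [].
  rewrite -bigcup_mkord => -[j /= jk xj] xk.
  have /trivIsetP /(_ j k Logic.I Logic.I) := tB.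
  rewrite neq_ltn jk => /(_ isT) BB.
  by have : (B j `&` B k) x by []; rewrite BB.
have /choice[g Cg] := hC.
have CC k : C k `<=` C k.+1 by rewrite /C big_ord_recr; left.
have [z _ Uz] := has_value_bigcup Cg CC.
exists z; suff -> : \bigcup_k B k = \bigcup_k C k by [].
apply/seteqP; split=> x.
  move=> [k _ xk]; exists k.+1 => //; rewrite /C -bigcup_mkord.
  by exists k => /=.
move=> [k _]; rewrite /C -bigcup_mkord => -[j _ xj].
by exists j.
Qed.

Theorem group_valued_measure : exists nu : set 'rV[R]_n -> G,
  [/\ forall A, borel_rV A -> 0 <= nu A,
    forall t, nu (orthant t) = f (t 0),
    nu setT = v,
    forall A B, borel_rV A -> borel_rV B -> A `&` B = set0 -> nu (A `|` B) = nu A + nu B &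
    forall A : nat -> set 'rV[R]_n, (forall k, borel_rV (A k)) ->
      (forall k, A k `<=` A k.+1) -> seq_lub (nu \o A) (nu (\bigcup_k A k))].
Proof.
pose nu A := xget 0 [set g | has_value A g].
have nuE A g : has_value A g -> nu A = g.
  move=> Ag; apply: (has_value_uniq (A := A)) => //.
  by have := @xgetPex _ 0 [set g | has_value A g]; apply; exists g.
have nuP A : borel_rV A -> has_value A (nu A).
  by move=> /has_value_exists[g Ag]; rewrite (nuE A g).
exists nu; split.
- by move=> A /nuP[].
- by move=> t; apply: nuE; apply: has_value_orthant.
- exact: nuE has_valueT.
- by move=> A B bA bB AB; apply: nuE; apply: has_value_setU => //; apply: nuP.
- move=> A bA AA; have [z zl Uz] := has_value_bigcup (fun k => nuP _ (bA k)) AA.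
  by rewrite (nuE _ z).
Qed.

End GroupMeasure.

(** * Spectral resolutions on lexicographic products *)

Section LexProduct.
Variables (H G : porderZmodType).
Hypotheses (hH : po_group H) (hG : po_group G).

Lemma lexprod_le (p q : lexprod H G) :
  p <= q <-> p.1 < q.1 \/ p.1 = q.1 /\ p.2 <= q.2.
Proof.
rewrite lexprod_leE; split=> [/orP[|/andP[/eqP]]|[->//|[/eqP -> ->]]]; rewrite ?orbT //.
  by left.
by right.
Qed.

Lemma lexprod_le1 (p q : lexprod H G) : p <= q -> p.1 <= q.1.
Proof. by move=> /lexprod_le[/ltW//|[->]]. Qed.

Lemma lexprod_le2 (p q : lexprod H G) : p <= q -> p.1 = q.1 -> p.2 <= q.2.
Proof. by move=> /lexprod_le[lt e|[]//]; rewrite e ltxx in lt. Qed.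

Lemma lexprod_leP (p q : lexprod H G) : p.1 <= q.1 -> (p.1 = q.1 -> p.2 <= q.2) -> p <= q.
Proof.
move=> le1 le2; apply/lexprod_le; have [e|ne] := eqVneq p.1 q.1.
  by right; split; [|apply: le2].
by left; rewrite lt_neqAle ne.
Qed.

Lemma po_lt (x y z : H) : x < y -> x + z < y + z.
Proof.
rewrite !lt_neqAle => /andP[ne le]; rewrite hH // andbT.
by apply: contra ne => /eqP /addIr ->.
Qed.

Lemma lexprod_po_group : po_group (lexprod H G).
Proof.
move=> x y z /lexprod_le[lt|[e le]]; apply/lexprod_le.
  by left; apply: po_lt.
by right; split; [rewrite /= e|apply: hG].
Qed.

(** Lowering a G-component by [g0] contradicts extremality of a supremum in the lexicographic order;
    when there is no such [g0], the order is that of H. *)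
Lemma directed_trivial : directed_group G ->
  (exists2 g0 : G, 0 <= g0 & ~ g0 <= 0) \/ forall g : G, g = 0.
Proof.
move=> dG; have [[g0 g00 ng0]|no] := pselect (exists2 g0 : G, 0 <= g0 & ~ g0 <= 0).
  by left; exists g0.
right=> g; have le0 x : x <= 0 :> G.
  have [c [c0 xc]] := dG 0 x; apply: le_trans xc _.
  by apply: contrapT => nc; apply: no; exists c.
apply: le_anti; rewrite le0 /=; have := le0 (- g) => h.
by apply: (po_le_by hG h); zmod.
Qed.

End LexProduct.

Lemma left_gap (R : realType) (C : seq R) (x : R) :
  exists2 y, y < x & forall c, c \in C -> c < x -> c < y.
Proof.
elim: C => [|c0 C [y yx yC]]; first by exists (x - 1) => //; rewrite gtrBl.
have [cx|xc] := ltP c0 x; last first.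
  exists y => // c; rewrite inE => /orP[/eqP ->|]; last exact: yC.
  by rewrite ltNge xc.
have [y' y1 y2] : exists2 y', Num.max y c0 < y' & y' < x.
  exists ((Num.max y c0 + x) / 2).
    by rewrite midf_lt ?gt_max ?yx.
  by rewrite midf_lt // gt_max yx.
move: y1; rewrite gt_max => /andP[y1 y1'].
exists y' => // c; rewrite inE => /orP[/eqP -> //|cC cx'].
exact: lt_trans (yC c cC cx') y1.
Qed.

Lemma right_gap (R : realType) (C : seq R) :
  exists2 e : R, 0 < e & forall c c', c \in C -> c' \in C -> c < c' + e -> c <= c'.
Proof.
suff [e e0 eC] : exists2 e : R, 0 < e &
    forall z, z \in [seq c - c' | c <- C, c' <- C] -> 0 < z -> e <= z.
  exists e => // c c' cC c'C cc'; rewrite leNgt; apply/negP => lt.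
  have := eC (c - c'); rewrite subr_gt0 lt => /(_ _ isT).
  move=> /(_ (allpairs_f _ cC c'C)); lra.
elim: [seq _ | _ <- _, _ <- _] => [|z s [e e0 es]]; first by exists 1.
have [z0|z0] := ltP 0 z; last first.
  exists e => // z'; rewrite inE => /orP[/eqP ->|]; last exact: es.
  by rewrite ltNge z0.
exists (Num.min e z); first by rewrite lt_min e0.
move=> z'; rewrite inE ge_min => /orP[/eqP -> _|/es h /h -> //].
by rewrite lexx orbT.
Qed.

Lemma seq_bounds (R : realType) (C : seq R) : exists M : R, forall c, c \in C -> - M < c < M.
Proof.
elim: C => [|c C [M MC]]; first by exists 0.
exists (Num.max M (`|c| + 1)) => c'; rewrite inE => /orP[/eqP ->|/MC /andP[h1 h2]].
  rewrite -ltr_norml; apply: lt_le_trans (_ : `|c| + 1 <= _); first by rewrite ltrDl.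
  by rewrite le_max lexx orbT.
by rewrite lt_max h2 ltrNl lt_max -ltrNl h1.
Qed.

Lemma count_lt (T : eqType) (a b : pred T) (s : seq T) x :
  subpred a b -> x \in s -> b x -> ~~ a x -> (count a s < count b s)%N.
Proof.
move=> ab xs bx nax; elim: s xs => //= y s IHs; rewrite inE => /orP[/eqP <-|/IHs lt].
  by rewrite (negPf nax) bx add0n add1n ltnS sub_count.
rewrite -addnS; apply: leq_add => //.
by case ay : (a y) => //; rewrite (ab y).
Qed.

Lemma vol_orthant (R : realType) (n : nat) (K : zmodType) (l r q : 'I_n -> R) (z : K) :
  (forall i, l i <= r i) ->
  vol l r (fun x => if [forall i, q i < x i] then z else 0) =
  if [forall i, l i <= q i < r i] then z else 0.
Proof.
move=> lr; case: ifP => [/forallP lqr|/negbT].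
  rewrite /vol (bigD1 finset.set0) //= cards0 /= big1 ?addr0 => [|S /set0Pn[i iS]].
    rewrite ifT //; apply/forallP => i; rewrite /mix inE.
    by case/andP: (lqr i).
  rewrite ifF ?signed0 //; apply/negP => /forallP /(_ i); rewrite /mix iS ltNge.
  by case/andP: (lqr i) => ->.
rewrite negb_forall => /existsP[i]; rewrite negb_and -ltNge -leNgt => iout.
apply: (vol_const (i := i)) => t; congr (if _ then _ else _).
apply: eq_forallb => j; rewrite /upd; case: eqP => // ->.
case/orP: iout => [ql|rq]; first by rewrite ql (lt_le_trans ql (lr i)).
by rewrite !ltNge rq (le_trans (lr i) rq).
Qed.

(** * Atoms and remainder of a spectral resolution *)

Section SpectralResolution.
Variables (R : realType) (n : nat) (H G : porderZmodType) (u : H).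
Variables (F : 'rV[R]_n -> lexprod H G).
Hypotheses (hG : po_group G) (dG : directed_group G).
Hypotheses (sG : monotone_sigma_complete G) (hH : po_group H).
Hypothesis hF : spectral_resolution u F.
Hypothesis iG : interpolation G.
Variables (i0 : 'I_n) (ps : seq 'rV[R]_n).
Hypothesis psP : characteristic_points u F = [set` ps].

Local Notation L := (lexprod H G).
Let hL : po_group L := lexprod_po_group hH hG.

Let Fx (x : 'I_n -> R) : L := F (\row_j x j).

Let FxE t : F t = Fx (t 0).
Proof. by congr F; apply/rowP => j; rewrite mxE. Qed.

Let Fx_ge0 x : 0 <= Fx x.
Proof. by have /andP[] := sr_in_ea hF (\row_j x j). Qed.

Let Fx_le x : Fx x <= ((u, 0) : L).
Proof. by have /andP[] := sr_in_ea hF (\row_j x j). Qed.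

Let Fx_vol (l r : 'I_n -> R) : (forall i, l i <= r i) -> 0 <= vol l r Fx.
Proof.
move=> lr; have := @sr_volume _ _ _ _ _ _ hF (\row_j l j) (\row_j r j) _ 0.
rewrite Delta_allE => h.
have -> : l = (\row_j l j) 0 by apply: funext => j; rewrite mxE.
have -> : r = (\row_j r j) 0 by apply: funext => j; rewrite mxE.
by apply: h => i; rewrite !mxE.
Qed.

Let Fx_left x y : (forall s, (forall i, s i < x i) -> Fx s <= y) ->
  0 <= y -> y <= ((u, 0) : L) -> Fx x <= y.
Proof.
move=> sy y0 yu; have [_ min] := sr_left_continuous hF (\row_j x j).
apply: min; split; first by rewrite /lex_ea /Gamma_ea /= y0.
move=> _ [s st <-]; rewrite FxE; apply: sy => i.
by have := st i; rewrite mxE.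
Qed.

Let Fx_lt_mono s t : (forall i, s i < t i) -> Fx s <= Fx t.
Proof.
move=> st; have [[_ ub] _] := sr_left_continuous hF (\row_j t j).
by apply: ub; exists (\row_j s j) => // i; rewrite !mxE.
Qed.

Let Fx_mono s t : (forall i, s i <= t i) -> Fx s <= Fx t.
Proof.
move=> st; apply: Fx_left => // s' s's; apply: Fx_lt_mono => i.
exact: lt_le_trans (s's i) (st i).
Qed.

Let h x := (Fx x).1.
Let g x := (Fx x).2.

Let h_ge0 x : 0 <= h x. Proof. exact: (lexprod_le1 (Fx_ge0 x)). Qed.
Let h_pos x : 0 < h x \/ h x = 0.
Proof. by have := h_ge0 x; rewrite le_eqVlt => /orP[/eqP|]; [right|left]. Qed.
Let h_le x : h x <= u. Proof. exact: (lexprod_le1 (Fx_le x)). Qed.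
Let h_mono s t : (forall i, s i <= t i) -> h s <= h t.
Proof. by move=> st; apply: lexprod_le1 (Fx_mono st). Qed.

Let in_ea (a : L) : 0 <= a -> a <= ((u, 0) : L) -> lex_ea u a.
Proof. by move=> a0 au; rewrite /lex_ea /Gamma_ea /= a0. Qed.

Let Fx_bot x i y : (forall r, y <= Fx (upd x i r)) -> lex_ea u y -> y <= 0.
Proof.
move=> yF yE; have [_ max] := sr_bottom hF (\row_j x j) i.
apply: max; split=> // _ [r _ <-]; rewrite FxE.
rewrite (_ : rV_upd _ _ _ 0 = upd x i r); first exact: yF.
by apply: funext => j; rewrite !mxE /upd; case: eqP.
Qed.

(** If [h] stayed at least [h t] along a whole line, [y] would be a lower bound of F there and
    contradict condition (iii). *)
Let small_elt t : 0 < h t ->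
  exists2 y : L, lex_ea u y & ~ y <= 0 /\ forall s, h t <= h s -> y <= Fx s.
Proof.
move=> ht0; have [[g0 g00 ng0]|tr] := directed_trivial hG dG.
  exists ((0, g0) : L).
    apply: in_ea; first by apply: lexprod_leP.
    apply/lexprod_le; left; exact: lt_le_trans ht0 (h_le t).
  split; first by move=> /lexprod_le2 /(_ erefl).
  by move=> s ts; apply/lexprod_le; left; apply: lt_le_trans ht0 ts.
exists (Fx t); first exact: in_ea.
split; first by move=> /lexprod_le1 /(lt_le_trans ht0); rewrite ltxx.
by move=> s ts; apply: lexprod_leP => // _; rewrite [(Fx t).2]tr [(Fx s).2]tr.
Qed.

(* By condition (iii) the block of [t] is bounded below, so that it has a
   characteristic point. *)
Let block_bound t : 0 < h t -> exists2 p, p \in ps & (forall i, p 0 i <= t i) /\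
  exists a : G, forall s, (forall i, p 0 i < s i) -> ((h t, a) : L) <= Fx s.
Proof.
move=> ht0; pose B := block_of u F (h t) (\row_j t j).
have Tt : Tset u F (h t) (\row_j t j) by split=> //; exact: (sr_in_ea hF).
have Bt : B (\row_j t j).
  split=> //; rewrite (_ : rV_meet _ _ = \row_j t j) //.
  by apply/rowP => j; rewrite !mxE minxx.
(* Somewhere to the left of [t] in direction [i] the value of [h] differs from [h t]. A member of
   the block further left would have a meet with [t] of level [h t], and monotonicity would force
   equality. *)
have low i : exists r, forall s, B s -> r <= s 0 i.
  have [r rt hr] : exists2 r, r <= t i & h (upd t i r) <> h t.
    apply: contrapT => nor; have [y yE [ny yF]] := small_elt ht0.
    apply: ny; apply: (Fx_bot (x := t) (i := i)) yE => r; apply: yF.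
    have [rt|/ltW tr] := leP r (t i).
      apply: contrapT => hr; apply: nor; exists r => // e.
      by apply: hr; rewrite e.
    by apply: h_mono => j; rewrite /upd; case: eqP => [->|].
  exists r => s [_ [_ hst]]; rewrite leNgt; apply/negP => /ltW sr.
  apply: hr; apply: le_anti; apply/andP; split.
    by apply: h_mono => j; rewrite /upd; case: eqP => [->|].
  rewrite -hst FxE; apply: h_mono => j; rewrite !mxE /upd ge_min.
  by case: eqP => [->|_]; rewrite ?sr ?lexx ?orbT.
pose p : 'rV[R]_n := \row_i inf [set s 0 i | s in B].
have pinf : rV_infimum B p.
  move=> i; rewrite mxE; have [r rB] := low i.
  split=> [_ [s Bs <-]|z zB].
    by apply: ge_inf; [exists r => _ [s' Bs' <-]; apply: rB|exists s].
  by apply: lb_le_inf => //; exists (t i), (\row_j t j) => //; rewrite mxE.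
have chp : characteristic_at u F (h t) p by exists B => //; exists (\row_j t j).
have pps : p \in ps.
  have : characteristic_points u F p by exists (h t); split.
  by rewrite psP.
exists p => //; clearbody p; split.
  move=> i; have [lb _] := pinf i; apply: lb.
  by exists (\row_j t j) => //; rewrite mxE.
have [a [[_ lba] _] [_ ah]] := sr_characteristic hF ht0 (h_le t) chp.
exists a.2 => s sp; rewrite -ah; have -> : (a.1, a.2) = a by case: (a).
by apply: lba; exists (\row_j s j) => // i; rewrite mxE; apply: sp.
Qed.

Let C : seq R := [seq (p : 'rV[R]_n) 0 i | p <- ps, i <- enum 'I_n].

Let psC (p : 'rV[R]_n) i : p \in ps -> p 0 i \in C.
Proof. by move=> pps; apply/allpairsP; exists (p, i); rewrite mem_enum. Qed.

(** A preorder whose classes are the grid cells, open on the left and closed on the right in each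
    coordinate, to suit left continuity. *)
Let cellle (s t : 'I_n -> R) := forall i c, c \in C -> c < s i -> c < t i.

(** The point [s0] lies beyond every grid value less than [t i]. For [s] below [t] the
    characteristic point of its block is thus strictly below [s0], so [h s <= h s0]. If [h] jumped
    at [t], [(h t, g t - g0)] would still bound these values. *)
Let left_near t : exists2 s0, (forall i, s0 i < t i) &
  forall s, (forall i, s0 i <= s i) -> (forall i, s i < t i) -> h s = h t.
Proof.
have /choice[s0 s0P] : forall i, exists y, y < t i /\ forall c, c \in C -> c < t i -> c < y.
  by move=> i; have [y] := left_gap C (t i); exists y.
exists s0; first by move=> i; case: (s0P i).
have hmax s : (forall i, s i < t i) -> h s <= h s0.
  move=> st; have [hs0|->] := h_pos s; last exact: h_ge0.
  have [p pps [ps' [a pa]]] := block_bound hs0.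
  apply: (lexprod_le1 (pa s0 _)) => i; have [_] := s0P i; apply; first exact: psC.
  exact: le_lt_trans (ps' i) (st i).
suff hs0 : h s0 = h t.
  by move=> s s0s st; rewrite -hs0; apply: le_anti; rewrite hmax //= h_mono.
apply: contrapT => ne.
have lt : h s0 < h t.
  rewrite lt_neqAle; apply/andP; split; first by apply/eqP.
  by apply: h_mono => i; have [/ltW] := s0P i.
have [[g0 g00 ng0]|tr] := directed_trivial hG dG; last first.
  have : Fx t <= Fx s0.
    apply: Fx_left => // s st; apply: lexprod_leP; first exact: hmax.
    by rewrite [(Fx s).2]tr [(Fx s0).2]tr.
  by move=> /lexprod_le1 /(lt_le_trans lt); rewrite ltxx.
have : Fx t <= ((h t, g t - g0) : L).
  apply: Fx_left.
  - by move=> s st; apply/lexprod_le; left; apply: le_lt_trans lt; apply: hmax.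
  - by apply/lexprod_le; left; apply: le_lt_trans lt.
  - apply: le_trans (Fx_le t); apply: lexprod_leP => // _ /=.
    by apply: (po_le_by hG g00); rewrite /g; zmod.
move=> /lexprod_le2 /(_ erefl) /= gt; apply: ng0.
by apply: (po_le_by hG gt); rewrite /g; zmod.
Qed.

(** The bound is the one attached to the block of a point slightly to the left of [t]: its
    characteristic point is strictly below [t], and being on the grid also strictly below [t']. *)
Let cell_bound t : exists a : G, forall t', cellle t t' -> ((h t, a) : L) <= Fx t'.
Proof.
have [ht0|ht0] := h_pos t; last by exists 0 => t' _; rewrite ht0; apply: Fx_ge0.
have [s0 s0t s0P] := left_near t.
have hs0 : h s0 = h t by apply: s0P.
have [|p pps [ps' [a pa]]] := @block_bound s0; first by rewrite hs0.
exists a => t' tt'; rewrite -hs0; apply: pa => i; apply: tt'; first exact: psC.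
exact: le_lt_trans (ps' i) (s0t i).
Qed.

Let cell_h s t : cellle s t -> h s <= h t.
Proof. by have [a sa] := cell_bound s; move=> /sa /lexprod_le1. Qed.

Let cell_h_eq s t : cellle s t -> cellle t s -> h s = h t.
Proof. by move=> st ts; apply: le_anti; rewrite !cell_h. Qed.

Let M : R := sval (cid (seq_bounds C)).
Let MC c : c \in C -> - M < c < M.
Proof. exact: (svalP (cid (seq_bounds C))). Qed.

Let low_h t i : t i <= - M -> h t = 0.
Proof.
move=> ti; have [h0|//] := h_pos t.
have [p pps [pt _]] := block_bound h0.
have /andP[Mp _] := MC (psC i pps).
by have := le_lt_trans (le_trans (pt i) ti) Mp; rewrite ltxx.
Qed.

(** Beyond the grid [h] is maximal. A maximum less than [u] would leave [(u, - g0)] as an upper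
    bound of F strictly below the top, against condition (iv). *)
Let high_h t : (forall i, M <= t i) -> h t = u.
Proof.
move=> tM; have hmax s : h s <= h t.
  by apply: cell_h => i c cC _; have /andP[_ cM] := MC cC; apply: lt_le_trans cM (tM i).
apply: contrapT => ne.
have lt : h t < u by rewrite lt_neqAle h_le andbT; apply/eqP.
have top (y : L) : 0 <= y -> y <= ((u, 0) : L) -> (forall s, Fx s <= y) -> ((u, 0) : L) <= y.
  move=> y0 yu yF; have [_ min] := sr_top hF; apply: min; split; first exact: in_ea.
  by move=> _ [s _ <-]; rewrite FxE; apply: yF.
have [[g0 g00 ng0]|tr] := directed_trivial hG dG; last first.
  have : ((u, 0) : L) <= Fx t.
    apply: top => // s; apply: lexprod_leP; first exact: hmax.
    by rewrite [(Fx s).2]tr [(Fx t).2]tr.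
  by move=> /lexprod_le1 /(lt_le_trans lt); rewrite ltxx.
have : ((u, 0) : L) <= ((u, - g0) : L).
  apply: top.
  - by apply/lexprod_le; left; apply: le_lt_trans lt.
  - by apply: lexprod_leP => // _ /=; apply: (po_le_by hG g00); zmod.
  - by move=> s; apply/lexprod_le; left; apply: le_lt_trans (hmax s) lt.
move=> /lexprod_le2 /(_ erefl) /= gt; apply: ng0.
by apply: (po_le_by hG gt); zmod.
Qed.

Let eps : R := s2val (cid2 (right_gap C)).
Let eps_gt0 : 0 < eps. Proof. exact: (s2valP (cid2 (right_gap C))). Qed.
Let eps_gap c c' : c \in C -> c' \in C -> c < c' + eps -> c <= c'.
Proof. exact: (s2valP' (cid2 (right_gap C))). Qed.

Let above (q : 'I_n -> R) (k : nat) : 'I_n -> R := fun i => q i + eps / k.+1%:R.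

Let step_gt0 k : 0 < eps / k.+1%:R.
Proof. by rewrite divr_gt0 ?ltr0n. Qed.

Let step_le k : eps / k.+1%:R <= eps.
Proof. by rewrite ler_pdivrMr ?ltr0n // ler_peMr ?ler1n // ltW. Qed.

Let box_mass (q : 'I_n -> R) (k : nat) : L := vol q (above q k) Fx.

Let fstB : {morph (fst : L -> H) : x y / x - y}. Proof. by []. Qed.
Let sndB : {morph (snd : L -> G) : x y / x - y}. Proof. by []. Qed.

Let above_gap q i c k : (forall i, q i \in C) -> c \in C -> c < above q k i -> c <= q i.
Proof.
move=> qC cC ck; apply: eps_gap => //; apply: lt_le_trans ck _.
by rewrite lerD2l.
Qed.

Let corner_cell q k k' (S : {set 'I_n}) : (forall i, q i \in C) ->
  cellle (mix S q (above q k)) (mix S q (above q k')).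
Proof.
move=> qC i c cC; rewrite /mix; case: ifP => // _ /above_gap.
by move=> /(_ qC cC) cq; apply: le_lt_trans cq _; rewrite ltrDl.
Qed.

Let box_mass1 q k : (forall i, q i \in C) -> (box_mass q k).1 = (box_mass q 0).1.
Proof.
move=> qC; rewrite /box_mass !(vol_morph _ _ _ fstB) /vol; apply: eq_bigr => S _.
by congr signed; apply: cell_h_eq; apply: corner_cell.
Qed.

Let box_mass_decr q k : (forall i, q i \in C) ->
  (box_mass q k.+1).2 <= (box_mass q k).2.
Proof.
move=> qC; apply: lexprod_le2; last by rewrite !box_mass1 // [RHS]box_mass1.
apply: (vol_sub hL) => // i; rewrite /above; first by rewrite lerDl ltW.
by rewrite lerD2l ler_pM2l // lef_pV2 ?posrE ?ltr0n // ler_nat.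
Qed.

(** Each signed corner is bounded below: a positive one by [cell_bound], as its cell does not change
    with [k], and a negative one by its value at [k = 0]. *)
Let box_mass_glb q : (forall i, q i \in C) ->
  exists w, seq_glb (fun k => (box_mass q k).2) w.
Proof.
move=> qC.
have /choice[a aP] : forall S : {set 'I_n}, exists a : G, forall k,
    a <= signed (odd #|S|) (g (mix S q (above q k))).
  move=> S; have [a aP] := cell_bound (mix S q (above q 0)).
  have heq k : h (mix S q (above q 0)) = h (mix S q (above q k)).
    by apply: cell_h_eq; apply: corner_cell.
  case: (odd _) => /=.
    exists (- g (mix S q (above q 0))) => k; apply: po_leN => //.
    apply: lexprod_le2; last by rewrite -[LHS](heq k).
    apply: Fx_mono => i; rewrite /mix; case: ifP => // _.
    by rewrite lerD2l ler_pM2l // lef_pV2 ?posrE ?ltr0n // ler_nat.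
  exists a => k; apply: (lexprod_le2 (aP _ _)); first exact: corner_cell.
  exact: heq.
apply: (@seq_glb_exists _ hG sG _ (\sum_S a S)) => k; first exact: box_mass_decr.
by rewrite /box_mass (vol_morph _ _ _ sndB) /vol; apply: po_sum_le.
Qed.

(* The atom of the measure at [q]; its second component is only constrained,
   and only matters, when the first one is positive. *)
Let atom (q : 'I_n -> R) : L :=
  ((box_mass q 0).1, if (box_mass q 0).1 == 0 then 0
                     else xget 0 [set w | seq_glb (fun k => (box_mass q k).2) w]).

Let atom_le q k : (forall i, q i \in C) -> (box_mass q 0).1 <> 0 ->
  (atom q).2 <= (box_mass q k).2.
Proof.
move=> qC /eqP/negPf m0; rewrite /atom /= m0.
have [w wP] := box_mass_glb qC.
have := @xgetPex _ 0 [set w | seq_glb (fun k => (box_mass q k).2) w].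
by move=> /(_ (ex_intro _ w wP)) [+ _]; apply.
Qed.

Let box_mass_ge0 q k : 0 <= box_mass q k.
Proof. by apply: Fx_vol => i; rewrite lerDl ltW. Qed.

Let atom_ge0 q : 0 <= atom q.
Proof.
have m0 : 0 <= (box_mass q 0).1 by apply: (lexprod_le1 (box_mass_ge0 q 0)).
apply: lexprod_leP => //= e; by rewrite -e eqxx.
Qed.

Let Q := {ffun 'I_n -> seq_sub C}.
Let qv (q : Q) : 'I_n -> R := fun i => ssval (q i).
Let qvC q i : qv q i \in C. Proof. exact: ssvalP. Qed.

Let jump (x : 'I_n -> R) : L :=
  \sum_(q : Q) if [forall i, qv q i < x i] then atom (qv q) else 0.

Let vol_jump l r : (forall i, l i <= r i) ->
  vol l r jump = \sum_(q : Q) if [forall i, l i <= qv q i < r i] then atom (qv q) else 0.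
Proof.
move=> lr; rewrite /jump (vol_sum _ _ (fun q x => if [forall i, qv q i < x i] then atom (qv q) else 0)).
by apply: eq_bigr => q _; rewrite vol_orthant.
Qed.

Let rest x : L := Fx x - jump x.

Let cell_jump s t : cellle s t -> cellle t s -> jump s = jump t.
Proof.
move=> st ts; apply: eq_bigr => q _; congr (if _ then _ else _).
by apply: eq_forallb => i; apply/idP/idP; [apply: st|apply: ts].
Qed.

Let vol1 l r : (vol l r Fx).1 = vol l r h.
Proof. exact: (vol_morph _ _ _ fstB). Qed.

Let vol_rest_nogrid l r i : (forall i, l i <= r i) ->
  (forall c, c \in C -> ~~ (l i <= c < r i)) ->
  (vol l r rest).1 = 0 /\ 0 <= (vol l r rest).2.
Proof.
move=> lr noc; rewrite /rest volB.
have cells t : cellle (upd t i (l i)) (upd t i (r i)) /\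
    cellle (upd t i (r i)) (upd t i (l i)).
  split=> j c cC; rewrite /upd; case: eqP => // _.
    by move=> cl; apply: lt_le_trans cl (lr i).
  by move=> cr; have := noc c cC; rewrite cr andbT ltNge.
rewrite [vol l r jump](vol_const (i := i)) ?subr0 => [|t]; last first.
  by have [? ?] := cells t; apply: cell_jump.
have V1 : (vol l r Fx).1 = 0.
  rewrite vol1 (vol_const (i := i)) // => t.
  by have [? ?] := cells t; apply: cell_h_eq.
by split=> //; apply: (lexprod_le2 (Fx_vol lr)).
Qed.

(** The box has the same first component as the small boxes at [q]. If this is not 0, a small box
    fits inside and its volume dominates the atom; if it is 0, the atom is 0 and the volume of F
    suffices. *)
Let vol_rest_atom l r q : (forall i, q i \in C) -> (forall i, l i <= q i < r i) ->
  (forall i c, c \in C -> l i <= c < r i -> c = q i) ->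
  (vol l r rest).1 = 0 /\ 0 <= (vol l r rest).2.
Proof.
move=> qC lqr uniq.
have lq i : l i <= q i by case/andP: (lqr i).
have qr i : q i < r i by case/andP: (lqr i).
have lr i : l i <= r i by apply: le_trans (lq i) (ltW (qr i)).
pose qf : Q := [ffun i => SeqSub (qC i)].
have qfE : qv qf = q by apply: funext => i; rewrite /qv ffunE.
have -> : vol l r rest = vol l r Fx - atom q.
  rewrite /rest volB vol_jump // (bigD1 qf) //= qfE ifT; last exact/forallP.
  rewrite big1 ?addr0 // => q' ne; case: ifP => // /forallP lq'r.
  case/eqP: ne; apply/ffunP => i; apply: val_inj; rewrite ffunE /=.
  exact: uniq (qvC q' i) (lq'r i).
have V1 k : (vol l r Fx).1 = (box_mass q k).1.
  rewrite box_mass1 // /box_mass !vol1 /vol; apply: eq_bigr => S _; congr signed.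
  apply: cell_h_eq => i c cC; rewrite /mix; case: ifP => _.
  - by move=> cl; apply: lt_le_trans cl (lq i).
  - move=> cr; have [lc|cl] := leP (l i) c; last first.
      by apply: lt_le_trans cl _; apply: le_trans (lq i) _; rewrite lerDl ltW.
    by rewrite (uniq i c cC) ?lc // ltrDl.
  - move=> cq; rewrite ltNge; apply/negP => lc.
    have := uniq i c cC; rewrite lc (lt_trans cq (qr i)) => /(_ isT) cE.
    by rewrite cE ltxx in cq.
  - by move=> /above_gap => /(_ qC cC) cq; apply: le_lt_trans cq (qr i).
split; first by rewrite /= (V1 0%N) subrr.
have [m0|m0] := eqVneq (box_mass q 0).1 0.
  rewrite /= m0 eqxx subr0; apply: (lexprod_le2 (Fx_vol lr)).
  by rewrite (V1 0%N) m0.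
have [k kP] : exists k : nat, forall i, above q k i <= r i.
  have [m mP] := fin_nat_bound (fun i => eps / (r i - q i)).
  exists m => i; rewrite -lerBrDl ler_pdivrMr ?ltr0n //.
  have rq : 0 < r i - q i by rewrite subr_gt0.
  have := mP i; rewrite ger0_norm; last by rewrite divr_ge0 // ltW.
  rewrite ler_pdivrMr // => h1; apply: le_trans h1 _; rewrite mulrC ler_pM2l //.
  by rewrite ler_nat.
have h1 : atom q <= box_mass q k.
  by apply: lexprod_leP => [|_]; [rewrite /= box_mass1|apply: atom_le => //; apply/eqP].
have h2 : box_mass q k <= vol l r Fx.
  by apply: (vol_sub hL) => // i; rewrite lerDl ltW.
have := le_trans h1 h2; rewrite -(po_sub_ge0 hL) => /lexprod_le2; apply.
by rewrite /= (V1 0%N) subrr.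
Qed.

Let vol_rest l r : (forall i, l i <= r i) -> (vol l r rest).1 = 0 /\ 0 <= (vol l r rest).2.
Proof.
(* Induction on the number of grid values met by the sides. If one side meets [c1 < c2], cutting at
   [c2] takes [c2] from the left half and [c1] from the right one. Otherwise some side meets none,
   or the box contains a single grid point. *)
pose N (l r : 'I_n -> R) := (\sum_i count (fun c => (l i <= c < r i)%R) C)%N.
have [m] := ubnP (N l r); elim: m l r => // m IHm l r Nm lr.
have [[i noc]|allc] := pselect (exists i, forall c, c \in C -> ~~ (l i <= c < r i)).
  exact: vol_rest_nogrid noc.
have [[i [c1 [c2 [c1C c2C lc1 c12 c2r]]]]|single] := pselect (exists i c1 c2,
    [/\ c1 \in C, c2 \in C, l i <= c1, c1 < c2 & c2 < r i]).
  have lc2 : l i <= c2 by apply: le_trans (ltW c12).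
  have decr (l' r' : 'I_n -> R) c : (forall j, l j <= l' j) -> (forall j, r' j <= r j) ->
      c \in C -> l i <= c < r i -> ~~ (l' i <= c < r' i) -> (N l' r' < m)%N.
    move=> ll rr cC cin cout; rewrite ltnS in Nm; apply: leq_trans Nm.
    have sub j : subpred (fun c => l' j <= c < r' j) (fun c => l j <= c < r j).
      by move=> z /andP[z1 z2]; rewrite (le_trans (ll j) z1) (lt_le_trans z2 (rr j)).
    rewrite /N (bigD1 i) //= [X in (_ < X)%N](bigD1 i) //= -addSn; apply: leq_add.
      exact: (count_lt (sub i) cC).
    by apply: leq_sum => j _; apply: sub_count; exact: sub.
  have [a1 a2] : (vol l (upd r i c2) rest).1 = 0 /\ 0 <= (vol l (upd r i c2) rest).2.
    apply: IHm.
    - apply: (decr _ _ c2) => //; first by move=> j; rewrite /upd; case: eqP => [->|//]; apply: ltW.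
        by rewrite lc2.
      by rewrite upd_same ltxx andbF.
    - by move=> j; rewrite /upd; case: eqP => [->|].
  have [b1 b2] : (vol (upd l i c2) r rest).1 = 0 /\ 0 <= (vol (upd l i c2) r rest).2.
    apply: IHm.
    - apply: (decr _ _ c1) => //; first by move=> j; rewrite /upd; case: eqP => [->|].
        by rewrite lc1 (lt_trans c12).
      by rewrite upd_same leNgt c12.
    - by move=> j; rewrite /upd; case: eqP => [->|//]; apply: ltW.
  rewrite (vol_split i c2) /= a1 b1 addr0; split=> //.
  by rewrite -[0]addr0; apply: po_leD.
have /choice[q qP] : forall i, exists c, c \in C /\ l i <= c < r i.
  move=> i; apply: contrapT => noc; apply: allc; exists i => c cC.
  by apply/negP => lcr; apply: noc; exists c.
apply: (@vol_rest_atom l r q) => [i|i|i c cC /andP[lc cr]]; try by case: (qP i).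
have [qC /andP[lq qr]] := qP i.
apply: contrapT => /eqP; rewrite neq_lt => /orP[cq|qc]; apply: single; exists i.
  by exists c, (q i).
by exists (q i), c.
Qed.

Let low_jump t i : t i <= - M -> jump t = 0.
Proof.
move=> ti; rewrite /jump big1 // => q _; case: ifP => // /forallP /(_ i) qt.
have /andP[Mq _] := MC (qvC q i).
by have := lt_trans (lt_le_trans qt ti) Mq; rewrite ltxx.
Qed.

(** In a box with lower corner beyond the grid, all corners but [x] contribute 0, so the value at
    [x] is a volume. *)
Let rest1 x : (rest x).1 = 0.
Proof.
pose l i := Num.min (- M) (x i).
have lx i : l i <= x i by rewrite ge_min lexx orbT.
have [v1 _] := vol_rest lx; move: v1; rewrite (vol_morph _ _ _ fstB) /vol.
rewrite (bigD1 finset.set0) //= cards0 big1 ?addr0 => [|S /set0Pn[i iS]].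
  by rewrite (_ : mix _ _ _ = x) //; apply: funext => i; rewrite /mix inE.
have li : mix S l x i <= - M by rewrite /mix iS ge_min lexx.
by rewrite /rest (low_jump li) subr0 -/(h _) (low_h li) signed0.
Qed.

Let f x : G := (rest x).2.

Let Fx_decomp x : Fx x = jump x + ((0, f x) : L).
Proof.
have -> : ((0, f x) : L) = rest x by rewrite /f -[in LHS](rest1 x); case: (rest x).
by rewrite /rest; zmod.
Qed.

Let h_jump x : h x = (jump x).1.
Proof. by rewrite /h Fx_decomp /= addr0. Qed.

Let g_jump x : g x = (jump x).2 + f x.
Proof. by rewrite /g Fx_decomp. Qed.

Let f_vol (l r : 'I_n -> R) : (forall i, l i <= r i) -> 0 <= vol l r f.
Proof. by move=> /vol_rest[_]; rewrite (vol_morph _ _ _ sndB). Qed.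

Let f_low x i : x i <= - M -> f x = g x.
Proof. by move=> xi; rewrite g_jump (low_jump xi) add0r. Qed.

Let f_low_ge0 x i : x i <= - M -> 0 <= f x.
Proof.
move=> xi; rewrite (f_low xi); apply: (lexprod_le2 (Fx_ge0 x)).
by rewrite [RHS](low_h xi).
Qed.

Let f_low_mono (x y : 'I_n -> R) i : (forall j, x j <= y j) -> y i <= - M -> f x <= f y.
Proof.
move=> xy yi; have xi : x i <= - M by apply: le_trans (xy i) yi.
rewrite (f_low xi) (f_low yi); apply: (lexprod_le2 (Fx_mono xy)).
by rewrite [LHS](low_h xi) [RHS](low_h yi).
Qed.

(** Here [h] vanishes, so with [z] the infimum in G the element [(0, z)] is below F on the whole
    line, and condition (iii) forces [z <= 0]. *)
Let f_low_lim (t : 'I_n -> R) i (c : R) : c <= - M -> decr_to0 (fun k => f (upd t i (c - k%:R))).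
Proof.
move=> cM.
have ck k : upd t i (c - k%:R) i <= - M.
  by rewrite upd_same lerBlDr (le_trans cM) // lerDl.
have dec k : f (upd t i (c - k.+1%:R)) <= f (upd t i (c - k%:R)).
  apply: (f_low_mono (i := i)) => // j; rewrite /upd; case: eqP => // _.
  by rewrite lerD2l lerN2 ler_nat.
have ge0 k : 0 <= f (upd t i (c - k%:R)) by apply: f_low_ge0 (ck k).
split=> //; split=> // y yf.
have [z [zf zmax]] := seq_glb_exists hG sG dec ge0.
apply: le_trans (zmax y yf) _.
have lez k : ((0, z) : L) <= Fx (upd t i (c - k%:R)).
  apply: lexprod_leP => [|_]; first exact: h_ge0.
  by rewrite -/(g _) -(f_low (ck k)).
suff : ((0, z) : L) <= 0 by move=> /lexprod_le2 /(_ erefl).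
apply: (Fx_bot (x := t) (i := i)); last first.
  apply: in_ea; last exact: le_trans (lez 0%N) (Fx_le _).
  by apply: lexprod_leP => // _; apply: zmax.
move=> r; have [k kP] := fin_nat_bound (fun _ : 'I_1 => c - r).
apply: le_trans (lez k) _; apply: Fx_mono => j; rewrite /upd; case: eqP => // _.
by rewrite lerBlDr -lerBlDl; apply: le_trans (ler_norm _) (kP ord0).
Qed.

Let f_mono (s t : 'I_n -> R) : (forall i, s i <= t i) -> f s <= f t.
Proof. exact: (increments_mono hG f_vol f_low_ge0 f_low_mono f_low_lim). Qed.

Let f_ge0 x : 0 <= f x.
Proof.
apply: (@le_trans _ _ (f (upd x i0 (Num.min (- M) (x i0))))).
  by apply: (f_low_ge0 (i := i0)); rewrite upd_same ge_min lexx.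
by apply: f_mono => j; rewrite /upd; case: eqP => // ->; rewrite ge_min lexx orbT.
Qed.

Let f_bot t i : decr_to0 (fun k => f (upd t i (- k%:R))).
Proof.
split=> [k|].
  apply: f_mono => j; rewrite /upd; case: eqP => // _.
  by rewrite lerN2 ler_nat.
split=> // y yf; have [_ [_ lim]] := f_low_lim t i (lexx (- M)).
apply: lim => k; have [m mP] := fin_nat_bound (fun _ : 'I_1 => M + k%:R).
apply: le_trans (yf m) _; apply: f_mono => j; rewrite /upd; case: eqP => // _.
by rewrite -opprD lerN2; apply: le_trans (ler_norm _) (mP ord0).
Qed.

Let total : L := \sum_(q : Q) atom (qv q).
(** Chosen so that [total + (0, v)] is the top [(u, 0)]. *)
Let v : G := - total.2.

Let high_jump t : (forall i, M <= t i) -> jump t = total.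
Proof.
move=> tM; apply: eq_bigr => q _; rewrite ifT //; apply/forallP => i.
by have /andP[_ qM] := MC (qvC q i); apply: lt_le_trans qM (tM i).
Qed.

Let total1 : total.1 = u.
Proof.
rewrite -(high_jump (t := fun=> M)) // -h_jump; exact: high_h.
Qed.

Let high_nat (x : 'I_n -> R) : exists m : nat, (forall i : 'I_n, M <= m%:R) /\
  forall i, x i <= m%:R.
Proof.
have [m mP] := fin_nat_bound x; have [m' mP'] := fin_nat_bound (fun _ : 'I_1 => M).
exists (maxn m m'); split=> i.
  by apply: le_trans (ler_norm _) (le_trans (mP' ord0) _); rewrite ler_nat leq_maxr.
by apply: le_trans (ler_norm _) (le_trans (mP i) _); rewrite ler_nat leq_maxl.
Qed.

Let f_le t : f t <= v.
Proof.
have [m [mM mt]] := high_nat t.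
apply: (@le_trans _ _ (f (fun=> m%:R))); first exact: f_mono.
have : g (fun=> m%:R) <= 0.
  by apply: (lexprod_le2 (Fx_le (fun=> m%:R))); apply: high_h.
rewrite g_jump (high_jump (t := fun=> m%:R)) // => le0.
by apply: (po_le_by hG le0); rewrite /v; zmod.
Qed.

Let f_top : seq_lub (fun k => f (fun=> k%:R)) v.
Proof.
split=> // y yf.
have [z [fz zmin]] : exists z, seq_lub (fun k => f (fun=> k%:R)) z.
  apply: (@seq_lub_exists _ sG _ v) => // k; apply: f_mono => i.
  by rewrite ler_nat.
apply: le_trans (zmin y yf).
have Fz m : (forall i : 'I_n, M <= m%:R) -> Fx (fun=> m%:R) <= ((u, total.2 + z) : L).
  move=> mM; apply: lexprod_leP => [|_]; first exact: h_le.
  rewrite -/(g _) g_jump (high_jump (t := fun=> m%:R)) //.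
  by apply: (po_le_by hG (fz m)); rewrite /=; zmod.
have [m0 [m0M _]] := high_nat (fun=> 0).
have zv : z <= v by apply: zmin.
have [_ min] := sr_top hF.
have : ((u, 0) : L) <= ((u, total.2 + z) : L).
  apply: min; split.
    apply: in_ea; first exact: le_trans (Fx_ge0 _) (Fz m0 m0M).
    by apply: lexprod_leP => // _ /=; apply: (po_le_by hG zv); rewrite /v; zmod.
  move=> _ [s _ <-]; have [m [mM ms]] := high_nat (s 0).
  by rewrite FxE; apply: le_trans (Fz m mM); apply: Fx_mono.
move=> /lexprod_le2 /(_ erefl) /= zt.
by apply: (po_le_by hG zt); rewrite /v; zmod.
Qed.

(** A sequence increasing to [t] inside the cell of [t] keeps both [h] and [jump] constant, so the
    supremum of the G-components there yields an upper bound of F below [t]. *)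
Let f_left t y : (forall s, (forall i, s i < t i) -> f s <= y) -> f t <= y.
Proof.
move=> sy.
have /choice[s0 s0P] : forall i, exists y, y < t i /\ forall c, c \in C -> c < t i -> c < y.
  by move=> i; have [z] := left_gap C (t i); exists z.
pose s k i := t i - (t i - s0 i) / k.+1%:R.
have ts0 i : 0 < t i - s0 i by rewrite subr_gt0; case: (s0P i).
have st k i : s k i < t i by rewrite gtrBl divr_gt0 ?ltr0n.
have s0s k i : s0 i <= s k i.
  by rewrite lerBrDr -lerBrDl ler_pdivrMr ?ltr0n // ler_peMr ?ler1n // ltW.
have cells k : cellle (s k) t /\ cellle t (s k).
  split=> i c cC; first by move=> cs; apply: lt_trans cs (st k i).
  by move=> ct; apply: lt_le_trans (s0s k i); have [_] := s0P i; apply.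
have hs k : h (s k) = h t by have [? ?] := cells k; apply: cell_h_eq.
have js k : jump (s k) = jump t by have [? ?] := cells k; apply: cell_jump.
have ss k : g (s k) <= g (s k.+1).
  apply: lexprod_le2; last by rewrite [LHS]hs [RHS]hs.
  apply: Fx_mono => i; rewrite lerD2l lerN2 ler_pM2l // lef_pV2 ?posrE ?ltr0n //.
  by rewrite ler_nat.
have sgt k : g (s k) <= g t.
  apply: lexprod_le2; last exact: hs.
  by apply: Fx_mono => i; apply: ltW.
have [z [sz zmin]] := seq_lub_exists sG ss sgt.
have zy : z <= (jump t).2 + y.
  apply: zmin => k; rewrite g_jump js.
  by apply: (po_le_by hG (sy (s k) (st k))); zmod.
have ht_z k : Fx (s k) <= ((h t, z) : L).
  by apply: lexprod_leP => [|_]; [rewrite -/(h _) hs|exact: sz].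
have : Fx t <= ((h t, z) : L).
  apply: Fx_left => [s' s't||].
  - have [k kP] := fin_nat_bound (fun i => (t i - s0 i) / (t i - s' i)).
    apply: le_trans (ht_z k); apply: Fx_mono => i.
    have ts' : 0 < t i - s' i by rewrite subr_gt0.
    rewrite lerBrDr -lerBrDl ler_pdivrMr ?ltr0n //.
    have := kP i; rewrite ger0_norm; last by rewrite divr_ge0 // ltW.
    rewrite ler_pdivrMr // mulrC => h1; apply: le_trans h1 _.
    by rewrite ler_pM2l // ler_nat.
  - exact: le_trans (Fx_ge0 _) (ht_z 0%N).
  - by apply: le_trans (Fx_le t); apply: lexprod_leP => // _; apply: zmin.
move=> /lexprod_le2 /(_ erefl) /= tz.
have := le_trans tz zy; rewrite -/(g _) g_jump => h1.
by apply: (po_le_by hG h1); zmod.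
Qed.

Let f_incr (s t : 'I_n -> R) i a : (forall j, s j <= t j) -> s i = t i ->
  a <= s i -> f s - f (upd s i a) <= f t - f (upd t i a).
Proof. exact: (increments_incr hG f_vol f_low_ge0 f_low_mono f_low_lim). Qed.

Theorem observable_extension : exists x : set 'rV[R]_n -> L,
  observable ((u, 0) : L) x /\ forall t, x [set s | rV_ll s t] = F t.
Proof.
have [nu [nu0 nuO nuT nuU nu_lub]] := group_valued_measure hG dG sG iG i0 f_vol
  f_mono f_ge0 f_le f_incr f_left f_bot f_top.
pose pt (q : Q) : 'rV[R]_n := \row_i qv q i.
pose J (A : set 'rV[R]_n) : L := \sum_(q : Q) if pt q \in A then atom (qv q) else 0.
pose x A : L := J A + ((0, nu A) : L).
have J_if A B q : (A `&` B = set0) ->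
    (if pt q \in A `|` B then atom (qv q) else 0) =
    (if pt q \in A then atom (qv q) else 0) + (if pt q \in B then atom (qv q) else 0).
  move=> AB; rewrite in_setU; case: (boolP (pt q \in A)) => qA /=; last by rewrite add0r.
  case: ifP => qB; last by rewrite addr0.
  have : (A `&` B) (pt q) by split; apply: set_mem.
  by rewrite AB.
have J_mono A B : A `<=` B -> J A <= J B.
  move=> AB; apply: (po_sum_le hL) => q _; case: ifP => qA; last by case: ifP.
  by rewrite ifT //; apply/mem_set/AB/set_mem.
have x_ge0 A : borel_rV A -> 0 <= x A.
  move=> bA; rewrite -[0]addr0; apply: (po_leD hL).
    by apply: (po_sum_ge0 hL) => q _; case: ifP.
  by apply: lexprod_leP => // _; apply: nu0.
have x_add A B : borel_rV A -> borel_rV B -> A `&` B = set0 -> x (A `|` B) = x A + x B.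
  move=> bA bB AB; rewrite /x nuU //.
  have -> : J (A `|` B) = J A + J B.
    by rewrite /J -big_split; apply: eq_bigr => q _; apply: J_if.
  have -> : ((0, nu A + nu B) : L) = ((0, nu A) : L) + ((0, nu B) : L).
    by congr pair; rewrite addr0.
  by rewrite addrACA.
have xT : x setT = ((u, 0) : L).
  rewrite /x nuT; have -> : J setT = total.
    by apply: eq_bigr => q _; rewrite in_setT.
  by congr pair; rewrite /= ?addr0 ?total1 // subrr.
have [_ bC bcup] := @smallest_sigma_algebra 'rV[R]_n setT [set A | open A].
have borelC (A : set 'rV[R]_n) : borel_rV A -> borel_rV (~` A).
  by move=> bA; have := bC A bA; rewrite setTD.
have borelU (A B : set 'rV[R]_n) : borel_rV A -> borel_rV B -> borel_rV (A `|` B).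
  move=> bA bB'; have -> : A `|` B = \bigcup_k (if k == 0%N then A else B).
    apply/seteqP; split=> y; first by case=> yAB; [exists 0%N|exists 1%N].
    by move=> [k _]; case: ifP => _; [left|right].
  by apply: bcup => k; case: ifP.
have x_le A : borel_rV A -> x A <= ((u, 0) : L).
  move=> bA; have bAC := borelC _ bA.
  have := x_add A (~` A) bA bAC (setICr A); rewrite setUv xT => ->.
  by have h1 := x_ge0 _ bAC; apply: (po_le_by hL h1); zmod.
exists x; split=> [|t]; last first.
  rewrite /x (nuO t) FxE [RHS]Fx_decomp; congr (_ + _).
  apply: eq_bigr => q _; congr (if _ then _ else _).
  apply/idP/forallP => [/set_mem qt i|qt]; first by have := qt i; rewrite mxE.
  by apply/mem_set => i; rewrite mxE.
split=> // [A bA|A B bA bB AB|A bA AA].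
- by rewrite /Gamma_ea /= x_ge0 // x_le.
- rewrite -x_add //; split=> //; apply: x_le.
  exact: borelU.
have bU : borel_rV (\bigcup_k A k).
  exact: bcup.
have [nuA nu_min] := nu_lub A bA (fun k => AA k k.+1 (leqnSn k)).
split; [split|].
- by rewrite /Gamma_ea /= x_ge0 // x_le.
- move=> _ [k _ <-]; apply: (po_leD hL); first by apply: J_mono => y yA; exists k.
  by apply: lexprod_leP => // _; apply: nuA.
move=> e [_ eub].
(* There are finitely many atoms, so [J (A l)] is constant from some index on, and from there only
   the second component varies. *)
have /choice[k kP] : forall q, exists k, (\bigcup_k A k) (pt q) -> A k (pt q).
  move=> q; have [[k _ qA]|nq] := pselect ((\bigcup_k A k) (pt q)); first by exists k.
  by exists 0%N.
pose k0 := (\max_q k q)%N.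
have JE l : (k0 <= l)%N -> J (A l) = J (\bigcup_k A k).
  move=> kl; apply: eq_bigr => q _; congr (if _ then _ else _).
  apply/idP/idP => /set_mem qA; apply/mem_set; first by exists l.
  apply: (AA (k q) l); last exact: kP.
  by apply: leq_trans kl; apply: (leq_bigmax q).
have xe l : (k0 <= l)%N -> J (\bigcup_k A k) + ((0, nu (A l)) : L) <= e.
  by move=> kl; rewrite -(JE l kl); apply: eub; exists l.
apply: lexprod_leP; first exact: (lexprod_le1 (xe k0 (leqnn _))).
move=> e1; suff : nu (\bigcup_k A k) <= e.2 - (J (\bigcup_k A k)).2.
  by move=> h1; apply: (po_le_by hG h1); rewrite /=; zmod.
apply: nu_min => l.
have := lexprod_le2 (xe (maxn l k0) (leq_maxr _ _)) e1.
have : nu (A l) <= nu (A (maxn l k0)).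
  set A1 := A l; set A2 := A _.
  have AA12 : A1 `<=` A2 by apply: AA; apply: leq_maxl.
  (* Monotonicity of [nu] comes from its positivity and additivity, applied to the difference of the
     two sets. *)
  have bD : borel_rV (A2 `\` A1).
    rewrite -(setCK (A2 `\` A1)) setCD; apply: (borelC).
    by apply: (borelU); [apply: (borelC)|]; apply: (bA).
  have := nu0 _ bD; rewrite -{2}(setDUK AA12) nuU ?setDIK //; last exact: bA.
  by move=> h1; apply: (po_le_by hG h1); zmod.
move=> h1 h2; apply: (po_le_by hG (po_leD hG h1 h2)); by rewrite /=; zmod.
Qed.

End SpectralResolution.

Theorem theorem4p4 (R : realType) (n : nat) (H G : porderZmodType) (u : H)
    (F : 'rV[R]_n -> lexprod H G) :
  (1 <= n)%N ->
  po_group G -> directed_group G -> monotone_sigma_complete G ->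
  interpolation G ->
  po_group H -> strong_unit u -> interpolation H ->
  spectral_resolution u F ->
  finite_set (characteristic_points u F) ->
  exists x : set 'rV[R]_n -> lexprod H G,
    observable ((u, 0) : lexprod H G) x /\
    forall t : 'rV[R]_n, x [set s | rV_ll s t] = F t.
Proof.
move=> n0 hG dG sG iG hH _ _ hF /finite_seqP[ps psP].
exact: (observable_extension hG dG sG hH hF iG (Ordinal n0) psP).
Qed.
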